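(* For all positive integers $n,m$, the bounded-error quantum query complexity of $f_{n,m}$ satisfies $Q(f_{n,m})=\tilde O(\sqrt n+\sqrt m)$.
   Context: Let $n,m$ be positive integers, $M=[n]\times[m]$ (a grid of cells with $n$ rows and $m$ columns), $\tilde M = M\cup\{\bot\}$ (pointers to cells, $\bot$ is the null pointer) and $\tilde C=[m]\cup\{\bot\}$ (pointers to columns). Let $T$ be the following fixed binary tree with $m$ leaves and $m-1$ internal nodes: if $m=2^k$, $T$ is the complete binary tree with $2^k$ leaves; if $2^k<m<2^{k+1}$, take the complete binary tree with $2^k$ leaves and add a pair of children to each of its $m-2^k$ leftmost leaves. The two outgoing arcs of each internal node are labeled 'left' and 'right', and the leaves are labeled $1,\dots,m$ from left to right. For a leaf $j$, $T(j)$ denotes the sequence of 'left'/'right' labels on the path from the root to leaf $j$. The input alphabet is $\Sigma=\{0,1\}\times\tilde M\times\tilde M\times\tilde C$; for $v\in\Sigma$ its four components are called $\mathrm{val}(v)$, $\mathrm{lpoint}(v)$, $\mathrm{rpoint}(v)$, $\mathrm{bpoint}(v)$. The function $f_{n,m}\colon\Sigma^M\to\{0,1\}$ is defined by $f_{n,m}(x)=1$ iff: (1) there is exactly one column $b\in[m]$ with $\mathrm{val}(x_{i,b})=1$ for all $i\in[n]$ (the marked column); (2) in column $b$ there is a unique cell $a$ with $x_a\ne(1,\bot,\bot,\bot)$ (the special element); (3) for each column $j\in[m]\setminus\{b\}$, the path starting at $a$ and following the pointers $\mathrm{lpoint},\mathrm{rpoint}$ as specified by the sequence $T(j)$ exists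 (no pointer on it is $\bot$) and ends in a cell $\ell_j$ lying in column $j$ with $\mathrm{val}(x_{\ell_j})=0$; (4) $\mathrm{bpoint}(x_{\ell_j})=b$ for every $j\in[m]\setminus\{b\}$. $Q(f)$ is the minimum number of queries of a quantum query algorithm that outputs $f(x)$ with probability at least $9/10$ on every input $x$; identifying $\Sigma$ with $[|\Sigma|]$, the query on input $x$ is the unitary $O_x|c,p\rangle|w\rangle=|c,\,p+x_c \bmod |\Sigma|\rangle|w\rangle$ for $c\in M$, $p\in\Sigma$. $\tilde O(\cdot)$ hides factors polylogarithmic in $n$ and $m$. *)

(* Defs.v *)
From mathcomp Require Import all_boot all_order all_algebra.
From mathcomp Require Import complex.
From mathcomp Require Import reals Rstruct.
From Stdlib Require Import Reals.

Set Implicit Arguments.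
Unset Strict Implicit.
Unset Printing Implicit Defensive.
Import GRing.Theory Num.Theory.

Definition Cx := complex Rdefinitions.R.

Section Fdef.
Variables n m : nat.

(* cells: row i in 'I_n (row i+1 of the paper), column j in 'I_m
   (column j+1 of the paper) *)
Definition cell := ('I_n * 'I_m)%type.

(* alphabet Sigma = {0,1} x M~ x M~ x C~ ; None plays the role of bot *)
Definition Sigma := (bool * option cell * option cell * option 'I_m)%type.

Definition sval (v : Sigma) : bool := v.1.1.1.
Definition lpoint (v : Sigma) : option cell := v.1.1.2.
Definition rpoint (v : Sigma) : option cell := v.1.2.
Definition bpoint (v : Sigma) : option 'I_m := v.2.

Definition trivial_sym : Sigma := (true, None, None, None).

(* binary expansion of i on k bits, most significant bit first;
   true = 'right', false = 'left' *)
Definition bits (k i : nat) : seq bool :=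
  [seq odd (i %/ 2 ^ (k.-1 - t)) | t <- iota 0 k].

(* T(j) for the 0-based leaf index j (= leaf j+1 of the paper).
   k = floor(log2 m), r = m - 2^k leaves of the complete tree with 2^k
   leaves get two children; leaves are numbered from left to right. *)
Definition tree_path (j : nat) : seq bool :=
  let k := trunc_log 2 m in
  let r := m - 2 ^ k in
  if j < 2 * r then rcons (bits k (j %/ 2)) (odd j)
  else bits k (j - r).

Fixpoint follow (x : {ffun cell -> Sigma}) (s : seq bool) (c : cell)
  : option cell :=
  match s with
  | [::] => Some c
  | d :: s' =>
      match (if d then rpoint (x c) else lpoint (x c)) with
      | Some c' => follow x s' c'
      | None => None
      end
  end.

Definition marked_col (x : {ffun cell -> Sigma}) (b : 'I_m) : bool :=
  [forall i : 'I_n, sval (x (i, b))].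

Definition f_nm (x : {ffun cell -> Sigma}) : bool :=
  [exists b : 'I_m,
    [&& marked_col x b,
        [forall b' : 'I_m, marked_col x b' ==> (b' == b)] &
        [exists a : cell,
          [&& a.2 == b,
              x a != trivial_sym,
              [forall a' : cell, ((a'.2 == b) && (a' != a)) ==> (x a' == trivial_sym)] &
              [forall j : 'I_m, (j != b) ==>
                 match follow x (tree_path j) a with
                 | Some l => [&& l.2 == j, ~~ sval (x l) & bpoint (x l) == Some b]
                 | None => false
                 end]]]]].

End Fdef.

(* Quantum query algorithms for functions f : Sigma^M -> {0,1}, where the
   input alphabet A is identified with [|A|] via enum_rank.
   Basis states: ((c, p), w) with c a query index, p in [|A|], and w a
   workspace index in 'I_d.                                              *)
Section Query.
Variables (I A : finType) (d : nat).

Definition qbasis := ((I * 'I_#|A|) * 'I_d)%type.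
Definition qdim := #|{: qbasis}|.

Local Open Scope ring_scope.

Definition oracle (x : {ffun I -> A}) : 'M[Cx]_qdim :=
  \matrix_(i < qdim, j < qdim)
    (let bi : qbasis := enum_val i in let bj : qbasis := enum_val j in
     if [&& bi.1.1 == bj.1.1, bi.2 == bj.2 &
            nat_of_ord bi.1.2 == modn (addn (nat_of_ord bj.1.2) (nat_of_ord (enum_rank (x bj.1.1)))) #|A|]
     then 1 else 0).

Definition adjoint (k l : nat) (U : 'M[Cx]_(k, l)) : 'M[Cx]_(l, k) := (map_mx Num.conj U)^T.

Definition unitary (U : 'M[Cx]_qdim) : bool := U *m adjoint U == 1%:M.

Definition final_state (U0 : 'M[Cx]_qdim) (Us : seq 'M[Cx]_qdim)
  (psi0 : 'cV[Cx]_qdim) (x : {ffun I -> A}) : 'cV[Cx]_qdim :=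
  foldl (fun psi U => U *m (oracle x *m psi)) (U0 *m psi0) Us.

Definition accept_prob (acc : {set qbasis}) (psi : 'cV[Cx]_qdim) : Cx :=
  \sum_(b in acc) `|psi (enum_rank b) 0| ^+ 2.

End Query.

Local Open Scope ring_scope.

Definition computes_with (I A : finType) (f : {ffun I -> A} -> bool) (T : nat)
  : Prop :=
  exists (d : nat) (psi0 : 'cV[Cx]_(qdim I A d)) (U0 : 'M[Cx]_(qdim I A d))
         (Us : seq 'M[Cx]_(qdim I A d)) (acc : {set qbasis I A d}),
    [/\ size Us = T,
        (adjoint psi0 *m psi0) = 1%:M,
        unitary U0,
        all (@unitary I A d) Us &
        forall x : {ffun I -> A},
          let p1 := accept_prob acc (final_state U0 Us psi0 x) in
          if f x then 9 / 10 <= p1 else 9 / 10 <= 1 - p1].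

Definition Q_le (I A : finType) (f : {ffun I -> A} -> bool) (T : nat) : Prop :=
  exists2 T' : nat, leq T' T & computes_with f T'.

(* Main.v *)
(* The quantum algorithm is built from Gram matrices alone. A family of states
   can be turned into another one at cost [w] when the difference of their Gram
   matrices equals [sum_q [x_q <> y_q] (P_q - N_q)] with [P_q], [N_q] positive
   semidefinite and [sum_q (P_q + N_q)(x, x) <= w x]. Such conversions compose
   exactly, like zero-error procedures with an input-dependent expected cost; a
   first-match search over [n] unit-cost tests costs [O(sqrt n)]. To run a
   conversion with bounded error, carry along the catalyst
   [1/sqrt K * (query vectors)] and move the weight from the initial to the final
   states by [1/K] per query: consecutive Gram matrices agree, so the required
   unitaries exist, and omitting the catalyst at the start causes an error of
   squared norm at most [w x / K].

   For [f_nm], fix a random sequence of rows. Call a column clear at level [k] if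
   its cells in the first [2^k - 1] sampled rows are nonzero; with high
   probability such a column has [O(n log / 2^k)] zeros. Starting from any column,
   descend: while the current column is not clear at the next level, find in it a
   zero whose back pointer leads to a column that is. One such round costs
   [~ sqrt n], as there are few zeros when testing a pointed column is expensive.
   If [f x = 1], every unmarked column contains a zero pointing to the marked
   one, so the descent ends there, and a last search verifies it exactly. *)
Require Import Defs.
From mathcomp Require Import all_boot all_order all_algebra.
From mathcomp Require Import complex reals Rstruct zify.
From Stdlib Require Import Reals.
From mathcomp Require Import ring lra.
(* [Reals] rebinds the key [N] and the power notation on [nat]. *)
Delimit Scope nat_scope with N.
Local Notation "a ^ b" := (expn a b) : nat_scope.

Set Implicit Arguments.
Unset Strict Implicit.
Unset Printing Implicit Defensive.
Import Order.TTheory GRing.Theory Num.Theory.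

(** * Exact conversions of Gram matrices *)

Section Conversion.
Local Open Scope ring_scope.
Variables (R : rcfType) (I A : eqType) (Y : finType) (inp : Y -> I -> A).
Implicit Types (D : Y -> Y -> R) (w : Y -> R).

(** A triple [(q, s, v)] is a rank-one piece [v v^T] of the semidefinite matrix attached to the
    query [q], counted negatively when [s] is true. *)
Definition term := (I * bool * (Y -> R))%type.

Definition differ (q : I) (x y : Y) : R := (inp x q != inp y q)%:R.

Definition term_val (t : term) (x y : Y) : R :=
  (-1) ^+ t.1.2 * differ t.1.1 x y * (t.2 x * t.2 y).

(* A kernel [D = rho - sigma] is convertible at cost [w] when the Gram matrix
   [rho] can be turned into [sigma] by a catalysed query: positive terms are
   catalyst vectors that get queried, negative ones get unqueried. *)
Definition convertible D w :=
  exists2 l : seq term,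
    forall x y, D x y = \sum_(t <- l) term_val t x y &
    forall x, \sum_(t <- l) t.2 x ^+ 2 <= w x.

Lemma convertible_ext D D' w w' :
  (forall x y, D x y = D' x y) -> (forall x, w x <= w' x) ->
  convertible D w -> convertible D' w'.
Proof.
move=> eqD lew [l Dl wl]; exists l => [x y|x]; first by rewrite -eqD.
exact: le_trans (wl x) (lew x).
Qed.

Lemma convertible0 : convertible (fun _ _ => 0) (fun=> 0).
Proof. by exists [::] => [x y|x]; rewrite big_nil. Qed.

Lemma convertibleD D1 D2 w1 w2 : convertible D1 w1 -> convertible D2 w2 ->
  convertible (fun x y => D1 x y + D2 x y) (fun x => w1 x + w2 x).
Proof.
move=> [l1 D1l w1l] [l2 D2l w2l]; exists (l1 ++ l2) => [x y|x].
  by rewrite big_cat /= -D1l -D2l.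
by rewrite big_cat lerD.
Qed.

Lemma convertibleN D w :
  convertible D w -> convertible (fun x y => - D x y) w.
Proof.
move=> [l Dl wl]; exists [seq (t.1.1, ~~ t.1.2, t.2) | t <- l] => [x y|x].
  rewrite big_map Dl -sumrN; apply: eq_bigr => t _.
  by rewrite /term_val /= signrN !mulNr.
by rewrite big_map /=; exact: wl.
Qed.

(** Running the conversion with amplitude [c x] on input [x] rescales every catalyst vector
    pointwise. *)
Lemma convertibleM (c : Y -> R) D w : convertible D w ->
  convertible (fun x y => c x * c y * D x y) (fun x => c x ^+ 2 * w x).
Proof.
move=> [l Dl wl]; exists [seq (t.1, fun x => c x * t.2 x) | t <- l] => [x y|x].
  rewrite big_map Dl mulr_sumr; apply: eq_bigr => t _.
  by rewrite /term_val /=; ring.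
rewrite big_map /=; under eq_bigr do rewrite exprMn.
by rewrite -mulr_sumr ler_wpM2l ?sqr_ge0.
Qed.

Lemma convertible_sum (T : Type) (s : seq T) (D : T -> Y -> Y -> R)
    (w : T -> Y -> R) :
  (forall t, convertible (D t) (w t)) ->
  convertible (fun x y => \sum_(t <- s) D t x y) (fun x => \sum_(t <- s) w t x).
Proof.
move=> Dw; elim: s => [|t s IH].
  by apply: (convertible_ext _ _ convertible0) => *; rewrite big_nil.
by apply: (convertible_ext _ _ (convertibleD (Dw t) IH)) => *; rewrite big_cons.
Qed.

Lemma sum_image_indicator (V : eqType) (g : Y -> V) (x : Y) (F : V -> R) :
  \sum_(v <- undup [seq g x | x <- enum Y]) (g x == v)%:R * F v = F (g x).
Proof.
rewrite (bigD1_seq (g x)) ?undup_uniq //=; last first.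
  by rewrite mem_undup map_f ?mem_enum.
rewrite eqxx mul1r big1 ?addr0 // => v.
by rewrite eq_sym => /negbTE ->; rewrite mul0r.
Qed.

(** Branches for distinct values of [g] are orthogonal: with amplitude [[g x = v]] on branch [v], an
    input pays only for the branch it takes. *)
Lemma convertible_switch (V : eqType) (g : Y -> V) (D : V -> Y -> Y -> R)
    (w : V -> Y -> R) :
  (forall v, convertible (D v) (w v)) ->
  convertible (fun x y => (g x == g y)%:R * D (g x) x y) (fun x => w (g x) x).
Proof.
move=> Dw; set s := undup [seq g x | x <- enum Y].
have := convertible_sum s (fun v => convertibleM (fun x => (g x == v)%:R) (Dw v)).
apply: convertible_ext => [x y|x].
  rewrite -[RHS](sum_image_indicator g x (fun v => (v == g y)%:R * D v x y)).
  by apply: eq_bigr => v _; rewrite (eq_sym v) mulrA.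
rewrite -[leRHS](sum_image_indicator g x (fun v => w v x)) le_eqVlt.
by apply/orP; left; apply/eqP/eq_bigr => v _; case: eqP; rewrite ?expr1n ?expr0n.
Qed.

(* Polarisation: [ab' + ba' = ((a+b)(a'+b') - (a-b)(a'-b')) / 2]. *)
Lemma convertible_cross (a b : Y -> R) D w : convertible D w ->
  convertible (fun x y => (a x * b y + b x * a y) * D x y)
              (fun x => (a x ^+ 2 + b x ^+ 2) * w x).
Proof.
move=> Dw; pose h := Num.sqrt (2^-1 : R).
have h2 : h * h = 2^-1 by rewrite -expr2 sqr_sqrtr ?invr_ge0 ?ler0n.
have Cp := convertibleM (fun x => h * (a x + b x)) Dw.
have Cm := convertibleN (convertibleM (fun x => h * (a x - b x)) Dw).
apply: convertible_ext (convertibleD Cp Cm) => [x y|x].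
  have E : forall u v z : R, h * u * (h * v) * z = 2^-1 * (u * v * z).
    by move=> u v z; rewrite -h2; ring.
  by rewrite !E; field.
by rewrite /= !exprMn [h ^+ 2]expr2 h2 le_eqVlt; apply/orP; left; apply/eqP; field.
Qed.

(** The kernel is the all-ones Gram matrix minus that of the orthonormal states [|g x>]: a fixed
    state is turned into [|g x>]. *)
Definition computable (V : eqType) (g : Y -> V) w :=
  convertible (fun x y => (g x != g y)%:R) w.

Lemma computable_le (V : eqType) (g : Y -> V) w w' :
  (forall x, w x <= w' x) -> computable g w -> computable g w'.
Proof. by move=> le_w; apply: convertible_ext. Qed.

Lemma computable_query q : computable (fun x => inp x q) (fun=> 1).
Proof.
exists [:: (q, false, fun=> 1)] => [x y|x]; rewrite big_seq1 ?expr1n //.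
by rewrite /term_val /= !mul1r mulr1.
Qed.

Lemma computable_const (V : eqType) (v : V) : computable (fun=> v) (fun=> 0).
Proof. by apply: convertible_ext (convertible0) => x // y; rewrite eqxx. Qed.

(** Sequential composition: two pairs differ either at [g], or at [h] once the values of [g]
    agree. *)
Lemma computable_pair (V V' : eqType) (g : Y -> V) (h : V -> Y -> V') w
    (w' : V -> Y -> R) :
  computable g w -> (forall v, computable (h v) (w' v)) ->
  computable (fun x => (g x, h (g x) x)) (fun x => w x + w' (g x) x).
Proof.
move=> gw hw; apply: convertible_ext (convertibleD gw (convertible_switch g hw)).
  move=> x y; rewrite -pair_eqE /pair_eq /=.
  by case: (eqVneq (g x) (g y)) => [<-|_]; rewrite ?add0r ?mul1r ?mul0r ?addr0.
by [].
Qed.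

(* Compute, copy the result, uncompute: hence twice the cost. *)
Lemma computable_comp (V V' : eqType) (g : Y -> V) (p : V -> V') w :
  computable g w -> computable (p \o g) (fun x => 2 * w x).
Proof.
move=> gw; have sw := convertible_switch (p \o g) (fun=> gw).
apply: convertible_ext (convertibleD gw (convertibleN sw)) => [x y|x] /=.
  case: (eqVneq (g x) (g y)) => [->|_]; first by rewrite eqxx mulr0 subrr.
  by case: eqP; rewrite ?mul1r ?mul0r ?subrr ?subr0.
by rewrite mulr2n mulrDl mul1r.
Qed.

(** Summed over [t], this singles out the first hit on [x] when it precedes the first hit on [y].
    Each summand is a function of [x] times one of [y], as polarisation requires; [p] selects where
    rejected inputs pay. *)
Definition first_weight (T : eqType) (s : seq T) (g p : T -> Y -> bool)
    (t : T) (x y : Y) : R :=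
  (index t s == find (g^~ x) s)%:R *
  ((index t s < find (g^~ y) s)%N && p t y)%:R.

(* The witness position of one input gets amplitude [sqrt c], the rejected
   positions of the other one get [1 / sqrt c]. *)
Lemma convertible_first (T : eqType) (s : seq T) (g p : T -> Y -> bool)
    (D : T -> Y -> Y -> R) (c W : R) :
  uniq s -> 0 < c -> 0 <= W ->
  (forall t, convertible (D t) (fun=> W)) ->
  convertible
    (fun x y => \sum_(t <- s)
      (first_weight s g p t x y + first_weight s g p t y x) * D t x y)
    (fun x => c * W + W / c * (count (p^~ x) s)%:R).
Proof.
move=> s_uniq c_gt0 W_ge0 Dw; pose r := Num.sqrt c.
have r2 : r ^+ 2 = c by rewrite sqr_sqrtr // ltW.
have r_neq0 : r != 0 by rewrite gt_eqF // sqrtr_gt0.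
pose a t x : R := r * (index t s == find (g^~ x) s)%:R.
pose b t x : R := r^-1 * ((index t s < find (g^~ x) s)%N && p t x)%:R.
have := convertible_sum s (fun t => convertible_cross (a t) (b t) (Dw t)).
apply: convertible_ext => [x y|x].
  apply: eq_bigr => t _; congr (_ * _); rewrite /a /b /first_weight.
  by field.
rewrite -mulr_suml big_split /= mulrDl; apply: lerD.
  rewrite ler_wpM2r //.
  under eq_bigr do rewrite exprMn r2.
  rewrite -mulr_sumr ler_piMr ?(ltW c_gt0) //.
  under eq_bigr => t _ do rewrite -natrX.
  rewrite -natr_sum lern1.
  case: (ltnP (find (g^~ x) s) (size s)) => [lt_s|ge_s]; last first.
    rewrite big_seq big1 // => t; rewrite -index_mem => t_s.
    by rewrite ltn_eqF // (leq_trans t_s).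
  have [t0 _] : exists2 t0 : T, t0 \in s & true.
    by case: (s) lt_s => // t s' _; exists t; rewrite ?mem_head.
  set t1 := nth t0 s (find (g^~ x) s).
  have t1_s : t1 \in s by apply: mem_nth.
  rewrite (bigD1_seq t1) //= index_uniq // eqxx big_seq_cond big1 // => t.
  case/andP=> t_s t_neq; case: eqP => // eq_t.
  by rewrite /t1 -eq_t nth_index // eqxx in t_neq.
rewrite mulrC -mulrA ler_wpM2l //.
under eq_bigr do rewrite exprMn exprVn r2.
rewrite -mulr_sumr ler_wpM2l ?invr_ge0 ?(ltW c_gt0) //.
under eq_bigr => t _ do rewrite -natrX.
rewrite -natr_sum ler_nat -sum1_count [leqRHS]big_mkcond /=.
by apply: leq_sum => t _; case: (p t x); case: (_ < _)%N.
Qed.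

Lemma first_weight_sum (T : eqType) (s : seq T) (g p : T -> Y -> bool)
    (D : T -> Y -> Y -> R) (x y : Y) :
  (forall t, t \in s -> g t x -> ~~ g t y -> p t y -> D t x y = 1) ->
  uniq s -> (find (g^~ x) s < find (g^~ y) s)%N ->
  \sum_(t <- s) (first_weight s g p t x y + first_weight s g p t y x) * D t x y
    = \sum_(t <- s) (index t s == find (g^~ x) s)%:R * (p t y)%:R.
Proof.
move=> D1 s_uniq lt_xy; rewrite big_seq [RHS]big_seq; apply: eq_bigr => t t_s.
rewrite /first_weight; set i := index t s.
have -> : (i == find (g^~ y) s)%:R * ((i < find (g^~ x) s)%N && p t x)%:R = 0 :> R.
  case: eqP => [->|_]; last by rewrite mul0r.
  by rewrite ltnNge (ltnW lt_xy) mulr0.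
rewrite addr0; case: eqP => [eq_i|_]; last by rewrite !mul0r.
rewrite eq_i lt_xy; case: (boolP (p t y)) => p_y; last by rewrite !(mulr0, mul0r).
rewrite !mul1r D1 //.
  move: (lt_xy) => /leq_trans /(_ (find_size _ _)); rewrite -has_find => h.
  by have := nth_find t h; rewrite -eq_i nth_index.
by have /= := before_find t lt_xy; rewrite -eq_i nth_index // => ->.
Qed.

Lemma first_weight_sum0 (T : eqType) (s : seq T) (g p : T -> Y -> bool)
    (D : T -> Y -> Y -> R) (x y : Y) :
  find (g^~ x) s = find (g^~ y) s ->
  \sum_(t <- s) (first_weight s g p t x y + first_weight s g p t y x) * D t x y
    = 0.
Proof.
move=> eq_xy; apply: big1 => t _; rewrite /first_weight eq_xy.
by case: eqP => [->|_]; rewrite ?ltnn ?mulr0 ?mul0r ?addr0 ?mul0r.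
Qed.

(** When two answers differ, only the smaller one contributes; there [g] accepts one value of [h t]
    and rejects the other, so the kernel of [h t] is 1. Taking [c] near [sqrt (size s)] gives cost
    [O(W * sqrt (size s))]. *)
Lemma computable_first (T : eqType) (s : seq T) (V : T -> eqType)
    (h : forall t, Y -> V t) (g : forall t, V t -> bool) (c W : R) :
  uniq s -> 0 < c -> 0 <= W ->
  (forall t, computable (h t) (fun=> W)) ->
  computable (fun x => find (fun t => g t (h t x)) s)
    (fun=> c * W + W / c * (size s)%:R).
Proof.
move=> s_uniq c_gt0 W_ge0 hW; set G := fun t x => g t (h t x).
have := convertible_first G (fun _ _ => true) s_uniq c_gt0 W_ge0 hW.
apply: convertible_ext => [x y|x]; last by rewrite count_predT.
have E x' y' : (find (G^~ x') s < find (G^~ y') s)%N ->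
  \sum_(t <- s) (first_weight s G (fun _ _ => true) t x' y' +
     first_weight s G (fun _ _ => true) t y' x') * (h t x' != h t y')%:R = 1.
  move=> lt_xy; rewrite (first_weight_sum (D := fun t x y => (h t x != h t y)%:R)) //.
    move: (lt_xy) => /leq_trans /(_ (find_size _ _)) lt_s.
    have [t0 _] : exists2 t0 : T, t0 \in s & true.
      by case: (s) lt_s => // t s' _; exists t; rewrite ?mem_head.
    rewrite (bigD1_seq (nth t0 s (find (G^~ x') s))) ?mem_nth //=.
    rewrite index_uniq // eqxx mulr1 big_seq_cond big1 ?addr0 // => t.
    case/andP=> t_s t_neq; case: eqP => [eq_t|_]; last by rewrite mul0r.
    by rewrite -eq_t nth_index // eqxx in t_neq.
  by move=> t _ gx gy _; case: eqP => // eq_h; move: gx gy; rewrite /G eq_h => ->.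
case: (ltngtP (find (G^~ x) s) (find (G^~ y) s)) => cmp.
- by rewrite E.
- rewrite -[RHS](E _ _ cmp); apply: eq_bigr => t _.
  by rewrite addrC eq_sym.
- by rewrite (first_weight_sum0 _ (fun t x y => (h t x != h t y)%:R)).
Qed.

(* A two-stage search: the expensive test [h] is charged only at the positions
   whose symbol passes the test [p]. *)
Lemma computable_first_filtered (T : eqType) (s : seq T) (q : T -> I)
    (p : A -> bool) (V : eqType) (h : T -> A -> Y -> V) (g : V -> bool)
    (c c' W : R) :
  uniq s -> 0 < c -> 0 < c' -> 0 <= W ->
  (forall t a, computable (h t a) (fun=> W)) ->
  computable
    (fun x => find (fun t => let a := inp x (q t) in p a && g (h t a x)) s)
    (fun x => c + (size s)%:R / c +
      (c' * W + W / c' * (count (fun t => p (inp x (q t))) s)%:R)).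
Proof.
move=> s_uniq c_gt0 c'_gt0 W_ge0 hW.
set G := fun t x => p (inp x (q t)) && g (h t (inp x (q t)) x).
pose P t x := p (inp x (q t)).
(* Two inputs are told apart at [t] by their symbols ([D1]) or, if these agree, by the test [h]
   ([D2]). *)
pose D1 t x y : R := (inp x (q t) != inp y (q t))%:R.
pose D2 t x y : R := (inp x (q t) == inp y (q t))%:R *
  (h t (inp x (q t)) x != h t (inp x (q t)) y)%:R.
have C1 := convertible_first G (fun _ _ => true) s_uniq c_gt0 ler01
  (fun t => computable_query (q t)).
have C2 := convertible_first G P s_uniq c'_gt0 W_ge0
  (fun t => convertible_switch (fun x => inp x (q t)) (hW t)).
apply: convertible_ext (convertibleD C1 C2) => [x y|x]; last first.
  by rewrite count_predT mulr1 mul1r [_ / c]mulrC.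
rewrite -big_split /=.
pose fw p t x y := first_weight s G p t x y.
pose F t x y := (fw (fun _ _ => true) t x y + fw (fun _ _ => true) t y x) * D1 t x y
  + (fw P t x y + fw P t y x) * D2 t x y.
rewrite (eq_bigr (F ^~ x ^~ y)) //.
have E x' y' : (find (G^~ x') s < find (G^~ y') s)%N ->
    \sum_(t <- s) F t x' y' = 1.
  move=> lt_xy; move: (lt_xy) => /leq_trans /(_ (find_size _ _)) lt_s.
  have [t0 _] : exists2 t0 : T, t0 \in s & true.
    by case: (s) lt_s => // t s' _; exists t; rewrite ?mem_head.
  set k := find (G^~ x') s in lt_xy lt_s *; set t1 := nth t0 s k.
  have t1_s : t1 \in s by apply: mem_nth.
  have Gx : G t1 x' by have := @nth_find _ t0 (G^~ x') s; rewrite has_find; apply.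
  have Gy : G t1 y' = false by exact: (@before_find _ t0 (G^~ y') s).
  have idx : index t1 s = k by rewrite /t1 index_uniq.
  have w0 p' t : fw p' t y' x' = 0.
    rewrite /fw /first_weight -/k; case: eqP => [->|_]; last by rewrite mul0r.
    by rewrite ltnNge (ltnW lt_xy) mulr0.
  have w1 p' : fw p' t1 x' y' = (p' t1 y')%:R.
    by rewrite /fw /first_weight -/k idx eqxx lt_xy mul1r.
  have w2 p' t : t \in s -> t != t1 -> fw p' t x' y' = 0.
    move=> t_s t_neq; rewrite /fw /first_weight -/k.
    case: eqP => [eq_t|_]; last by rewrite mul0r.
    by rewrite /t1 -eq_t nth_index // eqxx in t_neq.
  rewrite (bigD1_seq t1) //= big_seq_cond big1 => [|t /andP[t_s t_neq]]; last first.
    by rewrite /F !w0 !w2 // !addr0 !mul0r addr0.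
  rewrite /F !w0 !w1 !addr0 mul1r /D1 /D2.
  (* If the symbols agree at [t1], then [p] holds for [y'] as well, so the filtered weight does not
     vanish. *)
  move: Gx Gy; rewrite /G /P; case: eqP => [->|_]; last by rewrite mul0r mulr0 addr0.
  case: (p _) => //= Gx Gy; rewrite add0r !mul1r.
  by case: eqP => // eq_h; rewrite eq_h Gy in Gx.
case: (ltngtP (find (G^~ x) s) (find (G^~ y) s)) => cmp.
- by rewrite E.
- rewrite -[RHS](E _ _ cmp); apply: eq_bigr => t _.
  rewrite /F /D1 /D2 [inp y (q t) == _]eq_sym.
  congr (_ * _ + _ * _); rewrite 1?addrC //; case: eqP => [->|]; last by rewrite !mul0r.
  by rewrite eq_sym.
- apply: big1 => t _; rewrite /F /fw /first_weight cmp.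
  by case: eqP => [->|_]; rewrite ?ltnn /= !(mulr0, mul0r, addr0).
Qed.

End Conversion.

(** * Extending partial isometries *)

Section Householder.
Local Open Scope ring_scope.
Variables (F : realFieldType) (n : nat).
Implicit Types u v w : 'cV[F]_n.

Lemma scalar_mx11 (a : 'M[F]_1) : a = (a 0 0)%:M.
Proof. by apply/matrixP=> i j; rewrite !ord1 mxE eqxx. Qed.

Lemma dot_sym u v : u^T *m v = v^T *m u.
Proof. by rewrite [LHS]scalar_mx11 -tr_scalar_mx -scalar_mx11 trmx_mul trmxK. Qed.

Lemma dot_eq0 v : (v^T *m v == 0) = (v == 0).
Proof.
apply/eqP/eqP => [|->]; last by rewrite mulmx0.
move/matrixP/(_ 0 0); rewrite !mxE => /eqP; rewrite psumr_eq0 => [/allP v0|i _].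
  apply/matrixP => i j; rewrite ord1 mxE; apply/eqP.
  by have := v0 i (mem_index_enum _); rewrite mxE -expr2 sqrf_eq0.
by rewrite mxE -expr2 sqr_ge0.
Qed.

(** Householder reflection along [v - w]. A vector having equal products with [v] and [w] is
    orthogonal to [v - w], hence fixed. *)
Lemma reflection v w : v^T *m v = w^T *m w ->
  exists H : 'M[F]_n, [/\ H^T *m H = 1%:M, H *m v = w &
    forall u, u^T *m v = u^T *m w -> H *m u = u].
Proof.
move=> eq_vw; case: (eqVneq v w) => [<-|neq_vw].
  by exists 1%:M; split=> [||u _]; rewrite ?trmx1 ?mul1mx.
pose d := v - w; pose k := (d^T *m d) 0 0.
have kE : d^T *m d = k%:M by exact: scalar_mx11.
have k_neq0 : k != 0.
  apply: contra_neq neq_vw => k0; apply/eqP; rewrite -subr_eq0 -/d -dot_eq0 kE k0.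
  by apply/eqP/matrixP => i j; rewrite !mxE mul0rn.
pose H := 1%:M - (2 / k) *: (d *m d^T).
have HT : H^T = H by rewrite /H linearB linearZ /= trmx1 trmx_mul trmxK.
have HE u : H *m u = u - (2 / k) *: (d *m (d^T *m u)).
  by rewrite mulmxBl mul1mx -scalemxAl mulmxA.
have Hd : H *m d = - d.
  rewrite HE kE mul_mx_scalar scalerA mulfVK //.
  by rewrite scaler_nat mulr2n opprD addrA subrr sub0r.
have dv : d^T *m v = (k / 2)%:M.
  have : d^T *m d = (d^T *m v) *+ 2.
    rewrite /d mulmxBr !linearB /= !mulmxBl -eq_vw (dot_sym v w) mulr2n.
    by rewrite opprB.
  rewrite kE => eq_k; rewrite [LHS]scalar_mx11; congr (_%:M).
  by move/matrixP/(_ 0 0): eq_k; rewrite !mxE eqxx mulr1n => ->; field.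
exists H; split=> [||u eq_u].
- rewrite HT {2}/H mulmxBr mulmx1 -scalemxAr mulmxA Hd mulNmx scalerN opprK.
  by rewrite subrK.
- rewrite HE dv mul_mx_scalar scalerA mulrA divfK // divff ?pnatr_eq0 //.
  by rewrite scale1r /d opprB addrC subrK.
- rewrite HE [d^T *m u]dot_sym /d mulmxBr eq_u subrr mulmx0 scaler0.
  by rewrite subr0.
Qed.

(** An orthogonal map that is right on the tail is followed by the reflection repairing the head; by
    the Gram condition, that reflection fixes the images of the tail. *)
Lemma orthogonal_extension (s : seq ('cV[F]_n * 'cV[F]_n)) :
  {in s &, forall p q, p.1^T *m q.1 = p.2^T *m q.2} ->
  exists2 U : 'M[F]_n, U^T *m U = 1%:M & {in s, forall p, U *m p.1 = p.2}.
Proof.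
elim: s => [|p s IH] gram; first by exists 1%:M; rewrite ?trmx1 ?mul1mx.
have [|U U1 Us] := IH.
  by move=> q r q_s r_s; apply: gram; rewrite inE ?q_s ?r_s orbT.
have dotU u v : (U *m u)^T *m (U *m v) = u^T *m v.
  by rewrite trmx_mul mulmxA -(mulmxA _ U^T) U1 mulmx1.
have [|H [H1 Hp Hfix]] := @reflection (U *m p.1) p.2.
  by rewrite dotU gram ?mem_head.
exists (H *m U) => [|q]; first by rewrite trmx_mul mulmxA -(mulmxA _ H^T) H1 mulmx1.
rewrite inE -mulmxA => /predU1P[->//|q_s].
rewrite (Us _ q_s) Hfix // -{1}(Us _ q_s) dotU gram ?mem_head //.
by rewrite inE q_s orbT.
Qed.

End Householder.

(** * Running a conversion as a query algorithm *)

Section RealSimulation.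
Local Open Scope ring_scope.
Variables (F : rcfType) (I A L : finType).
Local Notation X := {ffun I -> A}.
Local Notation N := #|A|.
Local Notation basis := (qbasis I A #|L|).
Local Notation dim := (qdim I A #|L|).

(* Amplitude functions of states whose workspace is labelled by [L]. *)
Local Notation state := (L -> I -> 'I_N -> F).

Definition vec (u : state) : 'cV[F]_dim :=
  \col_i let b : basis := enum_val i in u (enum_val b.2) b.1.1 b.1.2.

Definition inner (u v : state) : F :=
  \sum_(l : L) \sum_(c : I) \sum_(p : 'I_N) u l c p * v l c p.

Lemma sum_basis (f : L -> I -> 'I_N -> F) :
  \sum_(b : basis) f (enum_val b.2) b.1.1 b.1.2 =
  \sum_(l : L) \sum_(c : I) \sum_(p : 'I_N) f l c p.
Proof.
rewrite -(pair_big predT predT (fun cp w => f (enum_val w) cp.1 cp.2)) /=.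
rewrite exchange_big /= (reindex enum_rank) /=; last first.
  by exists enum_val => x _; rewrite ?enum_rankK ?enum_valK.
apply: eq_bigr => l _.
rewrite -(pair_big predT predT (fun c p => f (enum_val (enum_rank l)) c p)) /=.
by rewrite enum_rankK.
Qed.

Lemma vec_dot (u v : state) : (vec u)^T *m vec v = (inner u v)%:M.
Proof.
rewrite [LHS]scalar_mx11; congr (_%:M); rewrite mxE.
rewrite (reindex enum_rank) /=; last first.
  by exists enum_val => x _; rewrite ?enum_rankK ?enum_valK.
rewrite /inner -(sum_basis (fun l c p => u l c p * v l c p)).
by apply: eq_bigr => b _; rewrite !mxE enum_rankK.
Qed.

Definition shift (k p : 'I_N) : 'I_N :=
  Ordinal (ltn_pmod (p + k) (leq_ltn_trans (leq0n p) (ltn_ord p))).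

Lemma shift_inj k : injective (shift k).
Proof.
move=> p p' /(congr1 val) /= /eqP.
by rewrite eqn_modDr !modn_small // => /eqP/val_inj.
Qed.

Definition real_oracle (x : X) : 'M[F]_dim :=
  \matrix_(i < dim, j < dim)
    (let bi : basis := enum_val i in let bj : basis := enum_val j in
     if [&& bi.1.1 == bj.1.1, bi.2 == bj.2 &
            nat_of_ord bi.1.2 == modn (addn (nat_of_ord bj.1.2) (nat_of_ord (enum_rank (x bj.1.1)))) #|A|]
     then 1 else 0).

Definition basis_shift (x : X) (b : basis) : basis :=
  (b.1.1, shift (enum_rank (x b.1.1)) b.1.2, b.2).

Lemma basis_shift_inj x : injective (basis_shift x).
Proof.
move=> [[c p] w] [[c' p'] w'] e.
have /= ec := congr1 (fun b => b.1.1) e; have /= ew := congr1 snd e.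
have /= ep := congr1 (fun b => b.1.2) e; move: ep; rewrite ec => /shift_inj ->.
by rewrite ew.
Qed.

Lemma real_oracleE x i j :
  real_oracle x i j = (enum_val i == basis_shift x (enum_val j))%:R.
Proof.
rewrite mxE /basis_shift; case: (enum_val i) (enum_val j) => [[c p] w] [[c' p'] w'].
rewrite !xpair_eqE -(val_eqE p) /=.
by case: (c == c'); case: (w == w'); rewrite ?andbT ?andbF //=; case: eqP.
Qed.

Lemma oracle_vec (x : X) (u v : state) :
  (forall l c p, v l c (shift (enum_rank (x c)) p) = u l c p) ->
  real_oracle x *m vec u = vec v.
Proof.
move=> uv; apply/colP => i; rewrite !mxE.
have [b eq_b] : exists b, enum_val i = basis_shift x b.
  have [g _ Kg] := injF_bij (@basis_shift_inj x).
  by exists (g (enum_val i)); rewrite Kg.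
rewrite eq_b /= uv (bigD1 (enum_rank b)) //= real_oracleE mxE enum_rankK eq_b eqxx.
rewrite mul1r big1 ?addr0 // => j neq_j; rewrite real_oracleE eq_b.
case: eqP => [/basis_shift_inj eq_bj|]; last by rewrite mul0r.
by rewrite eq_bj enum_valK eqxx in neq_j.
Qed.

Lemma real_oracle_orthogonal x : (real_oracle x)^T *m real_oracle x = 1%:M.
Proof.
apply/matrixP => i j; rewrite !mxE.
rewrite (bigD1 (enum_rank (basis_shift x (enum_val i)))) //= mxE !real_oracleE.
rewrite enum_rankK eqxx mul1r big1 => [|k neq_k].
  by rewrite addr0 (inj_eq (@basis_shift_inj x)) (inj_eq enum_val_inj).
rewrite mxE !real_oracleE.
case: eqP => [eq_k|]; last by rewrite mul0r.
by rewrite -eq_k enum_valK eqxx in neq_k.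
Qed.

Definition evolve (x : X) (U0 : 'M[F]_dim) (Us : seq 'M[F]_dim) :=
  foldl (fun M U => U *m (real_oracle x *m M)) U0 Us.

Lemma evolveE (x : X) (U0 : 'M[F]_dim) Us (psi : 'cV_dim) :
  foldl (fun psi U => U *m (real_oracle x *m psi)) (U0 *m psi) Us =
  evolve x U0 Us *m psi.
Proof.
by rewrite /evolve; elim: Us U0 => //= U Us IH U0; rewrite -IH !mulmxA.
Qed.

Lemma evolve_orthogonal (x : X) U0 Us : U0^T *m U0 = 1%:M ->
  {in Us, forall U : 'M_dim, U^T *m U = 1%:M} ->
  (evolve x U0 Us)^T *m evolve x U0 Us = 1%:M.
Proof.
rewrite /evolve; elim: Us U0 => //= U Us IH U0 U0_orth Us_orth; apply: IH.
  rewrite !trmx_mul !mulmxA -(mulmxA _ U^T) Us_orth ?mem_head // mulmx1.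
  by rewrite -(mulmxA _ (real_oracle x)^T) real_oracle_orthogonal mulmx1.
by move=> V V_Us; apply: Us_orth; rewrite inE V_Us orbT.
Qed.

End RealSimulation.

(** * Catalysed simulation of a family of conversions, with the seed in superposition *)

Section Transducer.
Local Open Scope ring_scope.
Variables (F : rcfType) (I A S : finType) (q0 : I) (a0 : A).
Local Notation X := {ffun I -> A}.
Local Notation N := #|A|.
Variables (l : S -> seq (term F I X)) (rep : S -> X -> X) (K : nat).
Hypothesis K_gt0 : (0 < K)%N.
Hypothesis l_rep : forall r x y,
  (rep r x != rep r y)%:R = \sum_(t <- l r) term_val (fun x : X => x) t x y.

(** Lists of terms are padded with zero terms, so that all seeds share one index type for the
    catalyst vectors. *)
Let M := \max_r size (l r).
Let t0 : term F I X := (q0, false, fun=> 0).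
Let tm r (i : 'I_M) := nth t0 (l r) i.

Lemma sum_terms (r : S) (f : term F I X -> F) : f t0 = 0 ->
  \sum_(i < M) f (tm r i) = \sum_(t <- l r) f t.
Proof.
move=> f0; have le_M : (size (l r) <= M)%N by apply: (leq_bigmax r).
rewrite (big_nth t0) big_mkord.
rewrite -(big_mkord predT (fun i => f (nth t0 (l r) i))).
rewrite (big_cat_nat (n := size (l r))) //= big_mkord [X in _ + X]big_nat [X in _ + X]big1 ?addr0 //.
by move=> i /andP[le_i _]; rewrite nth_default.
Qed.

(** Next to the seed stands [None] for the initial component, [Some v] for the final component with
    output [v], or the index of a catalyst vector. *)
Definition label := (S * (option X + 'I_M))%type.
Local Notation local := ((option X + 'I_M) -> I -> 'I_N -> F).

Definition zero_of (k : 'I_N) : 'I_N := Ordinal (leq_ltn_trans (leq0n k) (ltn_ord k)).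
Definition opp_of (k : 'I_N) : 'I_N :=
  Ordinal (ltn_pmod (N - k) (leq_ltn_trans (leq0n k) (ltn_ord k))).

Lemma shift_zero k : shift k (zero_of k) = k.
Proof. by apply: val_inj; rewrite /= add0n modn_small. Qed.

Lemma shift_opp k : shift k (opp_of k) = zero_of k.
Proof. by apply: val_inj; rewrite /= modnDml subnK ?modnn // ltnW. Qed.

Lemma zero_of_eq k k' : zero_of k = zero_of k'.
Proof. exact: val_inj. Qed.

Lemma opp_of_inj : injective opp_of.
Proof.
move=> k k' eq_k; apply: (@shift_inj _ (opp_of k)).
have shiftC (i j : 'I_N) : shift i j = shift j i.
  by apply: val_inj; rewrite /= addnC.
by rewrite {2}eq_k !(shiftC (opp_of _)) !shift_opp (zero_of_eq k k').
Qed.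

(* The query register of a catalyst vector before ([~~ post]) and after
   ([post]) the query; the sign of the term tells whether the query computes
   or uncomputes the symbol. *)
Definition pos (post : bool) (t : term F I X) (x : X) : 'I_N :=
  let k := enum_rank (x t.1.1) in
  if t.1.2 then (if post then zero_of k else opp_of k)
  else if post then k else zero_of k.

Lemma shift_pos t (x : X) : shift (enum_rank (x t.1.1)) (pos false t x) = pos true t x.
Proof. by rewrite /pos; case: t.1.2; rewrite ?shift_opp ?shift_zero. Qed.

(** For a positive term the register is blank before the query and holds the symbol after it; for a
    negative one it holds the inverse symbol before and is blank after. The loss of overlap is the
    signed term. *)
Lemma pos_diff t (x y : X) :
  ((pos false t x == pos false t y)%:R - (pos true t x == pos true t y)%:R) *
    (t.2 x * t.2 y) = term_val (fun x : X => x) t x y.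
Proof.
rewrite /term_val /differ /pos; case: t.1.2.
  rewrite (inj_eq opp_of_inj) (inj_eq enum_rank_inj) [zero_of _](zero_of_eq _ (enum_rank (y t.1.1))) eqxx.
  by case: eqP; rewrite /= ?subrr ?sub0r ?mulr1 ?mulr0 ?expr1.
rewrite (inj_eq enum_rank_inj) [zero_of _](zero_of_eq _ (enum_rank (y t.1.1))) eqxx.
by case: eqP; rewrite /= ?subrr ?subr0 ?expr0 ?mulr1 ?mulr0.
Qed.

Let eta : F := (Num.sqrt N%:R)^-1.

Lemma N_gt0 : (0 < N)%N.
Proof. by apply/card_gt0P; exists a0. Qed.

Lemma sum_eta2 : \sum_(p : 'I_N) eta * eta = 1.
Proof.
rewrite sumr_const card_ord -expr2 exprVn sqr_sqrtr ?ler0n //.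
by rewrite -[LHS]mulr_natr mulVf // pnatr_eq0 -lt0n N_gt0.
Qed.

(* Components outside the query register are spread uniformly over its
   contents, which makes them invariant under the oracle. *)
Definition loc (a b g : F) (post : bool) (r : S) (x : X) : local := fun k c p =>
  match k with
  | inl None => a * eta * (c == q0)%:R
  | inl (Some v) => b * eta * ((c == q0) && (v == rep r x))%:R
  | inr i => g * ((c == (tm r i).1.1) && (p == pos post (tm r i) x))%:R * (tm r i).2 x
  end.

Definition linner (u v : local) : F :=
  \sum_k \sum_(c : I) \sum_(p : 'I_N) u k c p * v k c p.

Lemma big_option (T : finType) (f : option T -> F) :
  \sum_(o : option T) f o = f None + \sum_(v : T) f (Some v).
Proof.
rewrite (bigD1 None) //=; congr (_ + _).
rewrite (reindex_omap Some (fun o => o)) /=; last by case.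
by apply: eq_bigl => v; rewrite eqxx.
Qed.

Lemma linner_loc a b g post r x y :
  linner (loc a b g post r x) (loc a b g post r y) =
  a ^+ 2 + b ^+ 2 * (rep r x == rep r y)%:R +
  g ^+ 2 * \sum_(i < M) (pos post (tm r i) x == pos post (tm r i) y)%:R *
    ((tm r i).2 x * (tm r i).2 y).
Proof.
rewrite /linner big_sumType /= big_option /=.
have sum_q (w : F) (B B' : bool) : \sum_(c : I) \sum_(p : 'I_N)
    (w * eta * ((c == q0) && B)%:R) * (w * eta * ((c == q0) && B')%:R) =
    w ^+ 2 * (B && B')%:R.
  rewrite (bigD1 q0) //= [X in _ + X]big1 => [|c /negbTE neq_c]; last first.
    by apply: big1 => p _; rewrite neq_c !mulr0.
  rewrite eqxx addr0 -[RHS]mulr1 -[X in _ = _ * X]sum_eta2 mulr_sumr; apply: eq_bigr => p _.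
  by case: B; case: B'; rewrite /= ?(mulr0, mul0r, mulr1); ring.
congr (_ + _ + _).
- have := sum_q a true true; rewrite mulr1 => <-.
  by apply: eq_bigr => c _; apply: eq_bigr => p _; rewrite andbT.
- under eq_bigr do rewrite sum_q.
  rewrite -mulr_sumr; congr (_ * _); rewrite (bigD1 (rep r x)) //= eqxx big1 ?addr0 //.
  by move=> v /negbTE ->.
- rewrite mulr_sumr; apply: eq_bigr => i _; set t := tm r i.
  rewrite (bigD1 t.1.1) //= [X in _ + X]big1 => [|c /negbTE neq_c]; last first.
    by apply: big1 => p _; rewrite neq_c mulr0 !mul0r.
  rewrite addr0 (bigD1 (pos post t x)) //= [X in _ + X]big1 => [|p /negbTE neq_p]; last first.
    by rewrite neq_p andbF mulr0 !mul0r.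
  by rewrite !eqxx addr0 /=; ring.
Qed.

Definition blocks (u : S -> local) : label -> I -> 'I_N -> F := fun z => u z.1 z.2.

Lemma inner_blocks u v : inner (blocks u) (blocks v) = \sum_r linner (u r) (v r).
Proof.
rewrite /inner /linner -(pair_big predT predT (fun r k =>
  \sum_c \sum_p blocks u (r, k) c p * blocks v (r, k) c p)) /=.
by [].
Qed.

Definition block (r : S) (u : local) : S -> local :=
  fun r' k c p => if r' == r then u k c p else 0.

Lemma inner_block r s u v :
  inner (blocks (block r u)) (blocks (block s v)) = (r == s)%:R * linner u v.
Proof.
rewrite inner_blocks (bigD1 r) //= [X in _ + X]big1 ?addr0 => [|r' /negbTE neq_r]; last first.
  apply: big1 => k _; apply: big1 => c _; apply: big1 => p _.
  by rewrite /block neq_r mul0r.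
rewrite /linner mulr_sumr; apply: eq_bigr => k _.
rewrite mulr_sumr; apply: eq_bigr => c _; rewrite mulr_sumr; apply: eq_bigr => p _.
by rewrite /block eqxx; case: eqP; rewrite ?mul1r ?mul0r ?mulr0.
Qed.

(** After [t] rounds, weight [t / K] has moved to the final component, and the catalyst is present
    with factor [1 / sqrt K]. The flag [post] tells whether the next query has been made. *)
Definition ideal (t : nat) (post : bool) (rx : S * X) :
    'cV[F]_(qdim I A #|{: label}|) :=
  vec (blocks (block rx.1 (loc (Num.sqrt (1 - t%:R / K%:R)) (Num.sqrt (t%:R / K%:R))
    (Num.sqrt (K%:R^-1)) post rx.1 rx.2))).

Lemma oracle_ideal t r x :
  real_oracle F _ x *m ideal t false (r, x) = ideal t true (r, x).
Proof.
apply: oracle_vec => [[r' k]] c p; rewrite /blocks /block /=; case: eqP => // _.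
case: k => [[v|]|i] //=; congr (_ * _%:R * _).
case: eqP => //= ->.
by rewrite -shift_pos (inj_eq (@shift_inj _ _)).
Qed.

(** The query lowers the catalyst's Gram matrix by [1 / K] times the kernel of [rep]; moving weight
    [1 / K] from the initial to the final component while resetting the catalyst compensates this
    exactly. *)
Lemma ideal_gram t rx sy : (t < K)%N ->
  (ideal t true rx)^T *m ideal t true sy =
  (ideal t.+1 false rx)^T *m ideal t.+1 false sy.
Proof.
case: rx sy => r x [s y] lt_tK; rewrite !vec_dot; congr (_%:M).
rewrite !inner_block; case: eqP => [<-|]; last by rewrite !mul0r.
rewrite !mul1r !linner_loc.
have K0 : K%:R != 0 :> F by rewrite pnatr_eq0 -lt0n.
have le1 (k : nat) : (k <= K)%N -> 0 <= 1 - k%:R / K%:R :> F.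
  by move=> le_k; rewrite subr_ge0 ler_pdivrMr ?ltr0n // mul1r ler_nat.
rewrite !sqr_sqrtr ?le1 ?divr_ge0 ?invr_ge0 ?ler0n // 1?ltnW //.
have := l_rep r x y; rewrite -(sum_terms r (f := fun t => term_val _ t x y)); last first.
  by rewrite /term_val /= mul0r mulr0.
under eq_bigr do rewrite -pos_diff mulrBl.
rewrite sumrB; case: (rep r x == rep r y) => /=; set a := \sum_i _; set b := \sum_i _.
  move/esym/eqP; rewrite subr_eq0 => /eqP ->.
  by rewrite -natr1; field.
by move/esym/eqP; rewrite subr_eq => /eqP ->; rewrite -natr1; field.
Qed.

Lemma run_ideal t : (t <= K)%N -> exists Us : seq 'M[F]_(qdim I A #|{: label}|),
  [/\ size Us = t, {in Us, forall U : 'M_(qdim I A #|{: label}|), U^T *m U = 1%:M} &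
    forall rx, evolve rx.2 1%:M Us *m ideal 0 false rx = ideal t false rx].
Proof.
elim: t => [|t IH] lt_tK.
  by exists [::]; split=> // rx; rewrite /evolve /= mul1mx.
have [Us [size_Us Us_orth run]] := IH (ltnW lt_tK).
have [|U U_orth U_run] := @orthogonal_extension F _
    [seq (ideal t true rx, ideal t.+1 false rx) | rx <- enum {: S * X}].
  by move=> _ _ /mapP[rx _ ->] /mapP[sy _ ->] /=; exact: ideal_gram.
exists (rcons Us U); split=> [|V|[r x]]; first by rewrite size_rcons size_Us.
  by rewrite mem_rcons inE => /predU1P[->|/Us_orth].
rewrite /evolve -cats1 foldl_cat /= -!mulmxA.
have /= -> := run (r, x); rewrite oracle_ideal.
by apply: (U_run (_, _)); apply/mapP; exists (r, x); rewrite ?mem_enum.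
Qed.

Definition sqnorm n (v : 'cV[F]_n) := \sum_i v i 0 ^+ 2.

Lemma sqnorm_dot n (v : 'cV[F]_n) : v^T *m v = (sqnorm v)%:M.
Proof.
rewrite [LHS]scalar_mx11 mxE; congr (_%:M).
by apply: eq_bigr => i _; rewrite mxE expr2.
Qed.

Lemma sqnorm_orthogonal n (U : 'M[F]_n) v :
  U^T *m U = 1%:M -> sqnorm (U *m v) = sqnorm v.
Proof.
move=> U_orth; have := sqnorm_dot (U *m v).
rewrite trmx_mul mulmxA -(mulmxA _ U^T) U_orth mulmx1 sqnorm_dot.
by move/matrixP/(_ 0 0); rewrite !mxE eqxx !mulr1n.
Qed.

Local Notation dim := (qdim I A #|{: label}|).
Local Notation Vec u := (vec (blocks u)) (only parsing).

Lemma sqnorm_blocks u : sqnorm (Vec u) = \sum_r linner (u r) (u r).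
Proof.
have := sqnorm_dot (Vec u); rewrite vec_dot => /matrixP/(_ 0 0).
by rewrite inner_blocks !mxE eqxx !mulr1n.
Qed.

Lemma linner_loc_diag a b g r x :
  linner (loc a b g false r x) (loc a b g false r x) =
  a ^+ 2 + b ^+ 2 + g ^+ 2 * \sum_(t <- l r) t.2 x ^+ 2.
Proof.
rewrite linner_loc eqxx mulr1 -(sum_terms r (f := fun t => t.2 x ^+ 2)) ?expr0n //.
by congr (_ + _ * _); apply: eq_bigr => i _; rewrite eqxx mul1r expr2.
Qed.

Let sigma : F := (Num.sqrt #|S|%:R)^-1.

Lemma sum_sigma2 (r0 : S) : \sum_(r : S) sigma ^+ 2 = 1.
Proof.
rewrite sumr_const exprVn sqr_sqrtr ?ler0n //.
rewrite -[LHS]mulr_natr mulVf // pnatr_eq0 -lt0n.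
by apply/card_gt0P; exists r0.
Qed.

(** The actual starting state: uniform over seeds and without catalyst, because it may not depend on
    [x]. *)
Definition init (x : X) : 'cV[F]_dim := Vec (fun r => loc sigma 0 0 false r x).

Lemma init_const x y : init x = init y.
Proof.
apply/colP => i; rewrite !mxE /blocks /loc.
by case: (enum_val _).2 => [[v|]|j]; rewrite ?mulr0 ?mul0r.
Qed.

Lemma sqnorm_init (r0 : S) x : sqnorm (init x) = 1.
Proof.
rewrite sqnorm_blocks -(sum_sigma2 r0); apply: eq_bigr => r _.
by rewrite linner_loc_diag expr0n /= mul0r !addr0.
Qed.

Lemma vec_blocks_sum (c : S -> F) (u v : S -> local) :
  (forall r k i p, u r k i p = c r * v r k i p) ->
  Vec u = \sum_r c r *: Vec (block r (v r)) :> 'cV[F]_dim.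
Proof.
move=> uv; apply/colP => i; rewrite !mxE summxE.
set b : qbasis I A _ := enum_val i; set z : label := enum_val b.2.
rewrite (bigD1 z.1) //= big1 => [|r /negbTE neq_r].
  by rewrite !mxE -/b -/z /blocks /block eqxx uv addr0.
by rewrite !mxE -/b -/z /blocks /block eq_sym neq_r mulr0.
Qed.

Section Error.
Variables (r0 : S) (x : X) (good : pred S) (W : F) (Us : seq 'M[F]_dim).
Hypotheses (good_cost : forall r, good r -> \sum_(t <- l r) t.2 x ^+ 2 <= W)
  (W_ge0 : 0 <= W) (W_K : 50 * W <= K%:R)
  (good_many : (100 * #|[pred r | ~~ good r]| <= #|S|)%N)
  (Us_orth : {in Us, forall U : 'M_dim, U^T *m U = 1%:M})
  (run : forall r, evolve x 1%:M Us *m ideal 0 false (r, x) = ideal K false (r, x)).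

Let gamma : F := Num.sqrt (K%:R^-1).
Let sg r : F := sigma * (good r)%:R.
Let E := evolve x 1%:M Us.

(** The start is the ideal state on good seeds plus a defect made of the bad seeds and the negated
    catalyst. The ideal part evolves exactly; the defect keeps its norm. *)
Lemma final_decomposition :
  E *m init x = Vec (fun r => loc 0 (sg r) (sg r * gamma) false r x) +
    E *m Vec (fun r => loc (sigma - sg r) 0 (- (sg r * gamma)) false r x).
Proof.
have K0 : K%:R != 0 :> F by rewrite pnatr_eq0 -lt0n.
have init_split : init x = Vec (fun r => loc (sg r) 0 (sg r * gamma) false r x)
    + Vec (fun r => loc (sigma - sg r) 0 (- (sg r * gamma)) false r x).
  apply/colP => i; rewrite !mxE /blocks /loc.
  by case: (enum_val _).2 => [[v|]|j]; ring.
rewrite init_split mulmxDr; congr (_ + _).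
rewrite (@vec_blocks_sum sg _ (fun r => loc 1 0 gamma false r x)); last first.
  by move=> r [[v|]|j] i p /=; ring.
rewrite (@vec_blocks_sum sg _ (fun r => loc 0 1 gamma false r x)); last first.
  by move=> r [[v|]|j] i p /=; ring.
rewrite mulmx_sumr; apply: eq_bigr => r _; rewrite -scalemxAr; congr (_ *: _).
have := run r; rewrite /ideal /= mul0r subr0 divff // subrr sqrtr0 sqrtr1.
by [].
Qed.

Lemma error_bound (T : {set qbasis I A #|{: label}|}) :
  (forall b r v, b \in T -> enum_val b.2 = (r, inl (Some v)) -> good r ->
    v != rep r x) ->
  \sum_(b in T) (E *m init x) (enum_rank b) 0 ^+ 2 <= 10^-1.
Proof.
move=> wrong; rewrite final_decomposition.
set u := Vec _; set d := Vec _.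
pose v := Vec (fun r => loc 0 0 (sg r * gamma) false r x) : 'cV[F]_dim.
have K0 : 0 < K%:R :> F by rewrite ltr0n.
have sigma2 : sigma ^+ 2 = #|S|%:R^-1 by rewrite exprVn sqr_sqrtr ?ler0n.
have WK_ge0 : 0 <= W / K%:R by rewrite divr_ge0 ?ler0n.
have WK_le : W / K%:R <= 50^-1.
  by rewrite ler_pdivrMr //; have := W_K; lra.
have r_cost r : (sg r * gamma) ^+ 2 * \sum_(t <- l r) t.2 x ^+ 2 <= sigma ^+ 2 * (W / K%:R).
  rewrite /sg; case: (boolP (good r)) => [/good_cost le_W|_].
    rewrite mulr1 exprMn -mulrA ler_wpM2l ?sqr_ge0 //.
    by rewrite sqr_sqrtr ?invr_ge0 ?ler0n // mulrC ler_wpM2r ?invr_ge0 ?ler0n.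
  by rewrite mulr0 mul0r expr0n /= mul0r mulr_ge0 ?sqr_ge0.
have v_le : sqnorm v <= 50^-1.
  apply: le_trans WK_le.
  rewrite sqnorm_blocks -[leRHS]mul1r -[X in _ <= X * _](sum_sigma2 r0) mulr_suml ler_sum // => r _.
  by rewrite linner_loc_diag expr0n /= !add0r.
have d_le : sqnorm d <= 100^-1 + 50^-1.
  apply: (@le_trans _ _ (100^-1 + W / K%:R)); last by rewrite lerD2l.
  rewrite sqnorm_blocks.
  apply: (@le_trans _ _ (\sum_r (sigma ^+ 2 * (~~ good r)%:R + sigma ^+ 2 * (W / K%:R)))).
    apply: ler_sum => r _; rewrite linner_loc_diag expr0n /= addr0 sqrrN.
    apply: lerD (r_cost r); rewrite /sg; case: (good r) => /=.
      by rewrite mulr1 subrr mulr0 expr0n.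
    by rewrite mulr0 subr0 mulr1.
  rewrite big_split /= -[X in _ + X <= _]mulr_suml sum_sigma2 // mul1r lerD2r.
  rewrite -mulr_sumr -natr_sum.
  rewrite sigma2 mulrC ler_pdivrMr ?ltr0n; last by apply/card_gt0P; exists r0.
  rewrite [leRHS]mulrC ler_pdivlMr ?ltr0n // -natrM ler_nat mulnC.
  apply: leq_trans good_many; rewrite leq_mul2l /= -sum1_card [leqRHS]big_mkcond /=.
  by apply: leq_sum => r _; rewrite inE; case: (good r).
(* [T] misses the correct outputs of good seeds, so on [T] the ideal final state has only its
   catalyst part [v]. *)
have u_le b : b \in T -> u (enum_rank b) 0 ^+ 2 <= v (enum_rank b) 0 ^+ 2.
  move=> b_T; rewrite !mxE enum_rankK /blocks /loc.
  case: (enum_val b.2) (fun r v => wrong b r v b_T) => r [[v'|]|j] //= wr.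
    rewrite /sg; case: (boolP (good r)) => [gr|_]; last by rewrite mulr0 !mul0r.
    have /negbTE -> := wr r v' erefl gr.
    by rewrite andbF !(mulr0, mul0r).
have sum_T (w : 'cV[F]_dim) : \sum_(b in T) w (enum_rank b) 0 ^+ 2 <= sqnorm w.
  rewrite /sqnorm [leRHS](reindex enum_rank) /=; last first.
    by exists enum_val => z _; rewrite ?enum_rankK ?enum_valK.
  rewrite big_mkcond; apply: ler_sum => b _.
  by case: ifP => // _; exact: sqr_ge0.
(* The bound is exactly [1 / 10]; the factors 2 come from
   [(p + e) ^+ 2 <= 2 * p ^+ 2 + 2 * e ^+ 2]. *)
apply: (@le_trans _ _ (2 * 50^-1 + 2 * (100^-1 + 50^-1))); last by lra.
apply: (@le_trans _ _ (2 * sqnorm v + 2 * sqnorm (E *m d))); last first.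
  by rewrite sqnorm_orthogonal ?lerD ?ler_wpM2l // evolve_orthogonal ?trmx1 ?mul1mx.
apply: le_trans (lerD (ler_wpM2l _ (sum_T v)) (ler_wpM2l _ (sum_T (E *m d)))) => //.
rewrite !mulr_sumr -big_split /=; apply: ler_sum => b /u_le.
rewrite [(u + _) _ _]mxE; set p := u _ _; set q := v _ _; set e := (E *m d) _ _.
have -> : (p + e) ^+ 2 = 2 * p ^+ 2 + 2 * e ^+ 2 - (p - e) ^+ 2 by ring.
by have := sqr_ge0 (p - e); move: (p ^+ 2) (q ^+ 2) (e ^+ 2) (_ ^+ 2) => *; lra.
Qed.

End Error.

End Transducer.

(** * Passage from real to complex amplitudes *)

Section Complexification.
Local Open Scope ring_scope.
Variables (I A : finType) (d : nat).
Local Notation F := Rdefinitions.R.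
Local Notation toC := (real_complex Rdefinitions.R).
Local Notation cplx := (map_mx toC).

Lemma adjoint_cplx k m (U : 'M[F]_(k, m)) : adjoint (cplx U) = cplx U^T.
Proof. by apply/matrixP => i j; rewrite !mxE; exact: conjc_real. Qed.

Lemma unitary_cplx (U : 'M[F]_(qdim I A d)) :
  U^T *m U = 1%:M -> unitary (cplx U).
Proof.
move=> /mulmx1C U_orth; rewrite /unitary adjoint_cplx -map_mxM U_orth.
by rewrite map_mx1.
Qed.

Lemma accept_prob_cplx (T : {set qbasis I A d}) (psi : 'cV[F]_(qdim I A d)) :
  accept_prob T (cplx psi) = toC (\sum_(b in T) psi (enum_rank b) 0 ^+ 2).
Proof.
rewrite /accept_prob rmorph_sum; apply: eq_bigr => b _.
by rewrite !mxE -add_Re2_Im2 /= expr0n addr0.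
Qed.

End Complexification.

Section CplxEvolution.
Local Open Scope ring_scope.
Variables (I A L : finType).
Local Notation F := Rdefinitions.R.
Local Notation toC := (real_complex Rdefinitions.R).
Local Notation cplx := (map_mx toC).

Lemma oracle_cplx (x : {ffun I -> A}) :
  oracle #|L| x = cplx (real_oracle F L x).
Proof. by apply/matrixP => i j; rewrite !mxE /=; case: ifP => _; rewrite ?rmorph1 ?rmorph0. Qed.

Lemma final_state_cplx (U0 : 'M[F]_(qdim I A #|L|)) Us psi (x : {ffun I -> A}) :
  final_state (cplx U0) [seq cplx U | U : 'M[F]_(qdim I A #|L|) <- Us] (cplx psi) x =
  cplx (evolve x U0 Us *m psi).
Proof.
rewrite /final_state -evolveE -map_mxM.
elim: Us (U0 *m psi) => //= U Us IH v.
by rewrite -IH oracle_cplx !map_mxM.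
Qed.

End CplxEvolution.

(** * From seeded exact conversions to bounded-error query algorithms *)

Section LasVegas.
Local Open Scope ring_scope.
Variables (I A S : finType) (f : {ffun I -> A} -> bool).
Local Notation X := {ffun I -> A}.
Local Notation F := Rdefinitions.R.

(** A good seed gives the right answer at cost at most [W]. With [50 * W] queries the missing
    catalyst has squared norm at most [1 / 50], and at most one seed in a hundred is bad. *)
Lemma las_vegas_quantum (q0 : I) (a0 : A) (r0 : S) (V : eqType)
    (h : S -> X -> V) (out : S -> V -> bool) (w : S -> X -> F)
    (good : X -> pred S) (W : nat) :
  (0 < W)%N ->
  (forall r, computable (fun x : X => x : I -> A) (h r) (w r)) ->
  (forall x r, good x r -> out r (h r x) = f x) ->
  (forall x r, good x r -> w r x <= W%:R) ->
  (forall x, 100 * #|[pred r | ~~ good x r]| <= #|S|)%N ->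
  Q_le f (50 * W).
Proof.
move=> W_gt0 h_comp good_out good_cost good_many.
have [l Dl wl] := fin_all_exists2 h_comp.
(* An output in [V] is encoded by a canonical input producing it, so the finite type of inputs
   serves as output register. *)
pose rep r x := odflt x [pick y | h r y == h r x].
have h_rep r x : h r (rep r x) = h r x.
  by rewrite /rep; case: pickP => [y /eqP|/(_ x)] //=; rewrite eqxx.
have rep_eq r x y : (rep r x == rep r y) = (h r x == h r y).
  apply/eqP/eqP => [eq_r|eq_h]; first by rewrite -h_rep eq_r h_rep.
  rewrite /rep eq_h; case: pickP => [//|/(_ x)] /=.
  by rewrite eq_h eqxx.
set K := (50 * W)%N; have K_gt0 : (0 < K)%N by rewrite muln_gt0.
have l_rep r x y :
    (rep r x != rep r y)%:R = \sum_(t <- l r) term_val (fun x : X => x) t x y.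
  by rewrite rep_eq -Dl.
have [Us [size_Us Us_orth run]] := run_ideal q0 a0 K_gt0 l_rep (leqnn K).
pose x0 : X := [ffun=> a0].
pose acc := [set b : qbasis I A #|{: label l}| |
  if (enum_val b.2 : label l) is (r, inl (Some v)) then out r (h r v) else false].
exists K => //; exists #|{: label l}|, (map_mx (real_complex _) (init q0 l rep x0)).
exists (map_mx (real_complex _) 1%:M), [seq map_mx (real_complex _) U | U <- Us], acc.
split=> [||||x].
- by rewrite size_map.
- by rewrite adjoint_cplx -map_mxM sqnorm_dot sqnorm_init // map_scalar_mx rmorph1.
- by apply: unitary_cplx; rewrite trmx1 mul1mx.
- by apply/allP => _ /mapP[U /Us_orth U_orth ->]; exact: unitary_cplx.
rewrite final_state_cplx accept_prob_cplx /= (init_const q0 l rep x0 x).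
set fin := evolve x 1%:M Us *m _.
have err (T : {set qbasis I A #|{: label l}|}) :
    (forall b r v, b \in T -> enum_val b.2 = (r, inl (Some v)) :> label l ->
       good x r -> v != rep r x) ->
    \sum_(b in T) fin (enum_rank b) 0 ^+ 2 <= 10^-1.
  apply: (@error_bound F I A S q0 a0 l rep K K_gt0 r0 x (good x) W%:R) => //.
  - by move=> r gr; apply: le_trans (wl r x) (good_cost x r gr).
  - by rewrite -natrM.
  - by move=> r; exact: (run (r, x)).
have total : \sum_b fin (enum_rank b) 0 ^+ 2 = 1.
  rewrite -(sqnorm_init q0 a0 l rep r0 x).
  rewrite -(@sqnorm_orthogonal F _ (evolve x 1%:M Us)); last first.
    by rewrite evolve_orthogonal // trmx1 mul1mx.
  rewrite /sqnorm [RHS](reindex enum_rank) //.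
  by exists enum_val => z _; rewrite ?enum_rankK ?enum_valK.
have toC (k : nat) : k%:R = real_complex _ k%:R :> Cx by rewrite rmorph_nat.
have c910 : 9 / 10 = real_complex _ (9 / 10) :> Cx by rewrite fmorph_div !rmorph_nat.
rewrite c910 -(rmorph1 (real_complex _)) -rmorphB !lecR.
have split_acc : \sum_(b in acc) fin (enum_rank b) 0 ^+ 2 +
    \sum_(b in ~: acc) fin (enum_rank b) 0 ^+ 2 = 1.
  rewrite -total [RHS](bigID (mem acc)) /=; congr (_ + _).
  by apply: eq_bigl => b; rewrite inE.
have acc_rep b r : enum_val b.2 = (r, inl (Some (rep r x))) :> label l ->
    good x r -> (b \in acc) = f x.
  by move=> eq_b gr; rewrite inE eq_b h_rep good_out.
case: ifP => fx.
  suff: \sum_(b in ~: acc) fin (enum_rank b) 0 ^+ 2 <= 10^-1 by lra.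
  apply: err.
  move=> b r v; rewrite inE => b_acc eq_b gr; apply: contraNneq b_acc => eq_v.
  by rewrite (acc_rep b r) // eq_b eq_v.
suff: \sum_(b in acc) fin (enum_rank b) 0 ^+ 2 <= 10^-1 by lra.
apply: err.
move=> b r v b_acc eq_b gr; apply: contraFneq fx => eq_v.
by rewrite -(acc_rep b r) // eq_b eq_v.
Qed.

End LasVegas.

(** * Searching for the marked column *)

Section ComputableMore.
Local Open Scope ring_scope.
Variables (R : rcfType) (I A : eqType) (Y : finType) (inp : Y -> I -> A).

Lemma computable_eq (V V' : eqType) (g : Y -> V) (g' : Y -> V') (w : Y -> R) :
  (forall x y, (g x == g y) = (g' x == g' y)) ->
  computable inp g w -> computable inp g' w.
Proof. by move=> eq_g; apply: convertible_ext => // x y; rewrite eq_g. Qed.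

Variables (V : eqType) (v0 : V) (st : nat -> V -> Y -> V).

(** The whole list is kept, newest first: each step is an exact pairing with the past, and costs add
    without uncomputation. *)
Fixpoint history (k : nat) (x : Y) : seq V :=
  if k is k'.+1 then st k' (head v0 (history k' x)) x :: history k' x else [:: v0].

Lemma computable_history (w : nat -> V -> Y -> R) k :
  (forall i v, (i < k)%N -> computable inp (st i v) (w i v)) ->
  computable inp (history k)
    (fun x => \sum_(i < k) w i (head v0 (history i x)) x).
Proof.
elim: k => [|k IH] w_st.
  apply: computable_le (computable_const R inp [:: v0]) => x.
  by rewrite big_ord0.
have := computable_pair (IH (fun i v lt_ik => w_st i v (ltnW lt_ik)))
  (fun h => w_st k (head v0 h) (ltnSn k)).
move=> H; apply: computable_le (computable_eq _ H) => [x|x y].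
  by rewrite big_ord_recr.
by rewrite xpair_eqE eqseq_cons andbC.
Qed.

End ComputableMore.

Section Algorithm.
Local Open Scope ring_scope.
Variables (R : rcfType) (n m K : nat).
Local Notation X := {ffun cell n m -> Sigma n m}.
Local Notation comp g w := (computable (fun x : X => x : cell n m -> Sigma n m) g w).

Fixpoint trace (x : X) (s : seq bool) (c : cell n m) : seq (Sigma n m) :=
  if s is d :: s' then
    x c :: (if (if d then rpoint (x c) else lpoint (x c)) is Some c'
            then trace x s' c' else [::])
  else [:: x c].

(** Recovers the end of the path and its symbol from the recorded symbols alone, which makes the
    leaf test a function of a computable value. *)
Fixpoint replay (s : seq bool) (c : cell n m) (tr : seq (Sigma n m)) :
    option (cell n m * Sigma n m) :=
  match s, tr with
  | [::], a :: _ => Some (c, a)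
  | d :: s', a :: tr' =>
      if (if d then rpoint a else lpoint a) is Some c' then replay s' c' tr' else None
  | _, [::] => None
  end.

Lemma replay_trace x s c :
  replay s c (trace x s c) = omap (fun l => (l, x l)) (follow x s c).
Proof.
by elim: s c => //= d s IH c; case: (if d then _ else _) => //= c'.
Qed.

Lemma computable_trace s c :
  comp (fun x => trace x s c) (fun=> (size s).+1%:R : R).
Proof.
elim: s c => [|d s IH] c /=.
  apply: computable_eq (computable_query R _ c) => x y.
  by rewrite eqseq_cons andbT.
pose h a (x : X) := if (if d then rpoint a else lpoint a) is Some c'
  then trace x s c' else [::].
have h_comp a : comp (h a) (fun=> (size s).+1%:R : R).
  rewrite /h; case: (if d then _ else _) => [c'|]; first exact: IH.
  by apply: computable_le (computable_const R _ _) => x; rewrite ler0n.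
have H := computable_pair (computable_query R _ c) h_comp.
apply: computable_le (computable_eq _ H) => [x|x y].
  by rewrite -[in leRHS]natr1 addrC.
by rewrite xpair_eqE eqseq_cons.
Qed.

End Algorithm.

(** An integer within a factor [sqrt 2] of [sqrt (2 ^ k)]. *)
Definition mu k := 2 ^ k./2.

Lemma mu_gt0 k : 0 < mu k.
Proof. by rewrite expn_gt0. Qed.

Lemma mu_sqr_le k : mu k ^ 2 <= 2 ^ k.
Proof. by rewrite -expnM leq_exp2l // muln2 -{2}(odd_double_half k) leq_addl. Qed.

Lemma le_mu_sqr k : 2 ^ k <= 2 * mu k ^ 2.
Proof.
by rewrite -expnM -expnS leq_exp2l // muln2 -{1}(odd_double_half k) -add1n
           leq_add2r leq_b1.
Qed.

(** * Sampling tests and the descent through columns *)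

Section Search.
Local Open Scope ring_scope.
Variables (R : rcfType) (n m K : nat) (sample : {ffun 'I_(2 ^ K) -> 'I_n}).
Local Notation X := {ffun cell n m -> Sigma n m}.
Local Notation comp g w := (computable (fun x : X => x : cell n m -> Sigma n m) g w).

(** The [- 1] makes level 0 empty, so every starting column is clear there. *)
Definition positions k : seq 'I_(2 ^ K) :=
  [seq t : 'I_(2 ^ K) <- enum 'I_(2 ^ K) | (t < 2 ^ k - 1)%N].

Lemma size_positions k : (k <= K)%N -> size (positions k) = (2 ^ k - 1)%N.
Proof.
move=> le_kK; rewrite /positions size_filter -(count_map val (fun t => t < 2 ^ k - 1)%N).
rewrite val_enum_ord -size_filter (@filter_iota_ltn 0) ?size_iota //.
by rewrite (leq_trans (leq_subr _ _)) // leq_exp2l.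
Qed.

Lemma positions_uniq k : uniq (positions k).
Proof. by rewrite filter_uniq ?enum_uniq. Qed.

Definition hit k (j : 'I_m) (x : X) :=
  find (fun t => ~~ Defs.sval (x (sample t, j))) (positions k).

Definition clear k j x := hit k j x == size (positions k).

Lemma clearP k j x : clear k j x = all (fun t => Defs.sval (x (sample t, j))) (positions k).
Proof.
rewrite /clear /hit -[RHS]negbK -has_predC has_find.
by rewrite ltn_neqAle find_size andbT negbK.
Qed.

Lemma computable_hit k j : (k <= K)%N -> comp (hit k j) (fun=> 3 * (mu k)%:R : R).
Proof.
move=> le_kK; have mu0 : 0 < (mu k)%:R :> R by rewrite ltr0n mu_gt0.
have H := computable_first (fun _ (a : Sigma n m) => ~~ Defs.sval a) (positions_uniq k) mu0
  ler01 (fun t => computable_query R (fun x : X => x : cell n m -> Sigma n m) (sample t, j)).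
apply: computable_le H => x; rewrite mulr1 mul1r size_positions //.
suff: (mu k)%:R^-1 * (2 ^ k - 1)%:R <= 2 * (mu k)%:R :> R by lra.
rewrite mulrC ler_pdivrMr // -natrM -natrM ler_nat -mulnA.
by apply: leq_trans (le_mu_sqr k); rewrite leq_subr.
Qed.

Definition pointing (a : Sigma n m) := ~~ Defs.sval a && (bpoint a != None).

Definition next_row k (j : 'I_m) (x : X) :=
  find (fun i : 'I_n => let a := x (i, j) in
    pointing a && ((if bpoint a is Some b then hit k b x else 0%N) == size (positions k)))
  (enum 'I_n).

(** With [c = nu] and [c' = nu / mu k], scanning the rows costs at most [2 * nu], the accepted test
    [3 * nu], and each rejected test at most [3 * 2 ^ k / nu], charged only at pointing zeros. *)
Lemma computable_next_row k j (nu : nat) : (k <= K)%N -> (0 < nu)%N -> (n <= nu ^ 2)%N ->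
  comp (next_row k j) (fun x => 5 * nu%:R +
    3 * 2 ^+ k / nu%:R * (count (fun i : 'I_n => pointing (x (i, j))) (enum 'I_n))%:R : R).
Proof.
move=> le_kK nu_gt0 n_le; have nu0 : 0 < nu%:R :> R by rewrite ltr0n.
have mu0 : 0 < (mu k)%:R :> R by rewrite ltr0n mu_gt0.
pose h (i : 'I_n) (a : Sigma n m) x := if bpoint a is Some b then hit k b x else 0%N.
have h_comp i a : comp (h i a) (fun=> 3 * (mu k)%:R : R).
  rewrite /h; case: (bpoint a) => [b|]; first exact: computable_hit.
  apply: computable_le (computable_const R _ _) => x.
  by rewrite mulr_ge0 ?ler0n.
have W0 : 0 <= 3 * (mu k)%:R :> R by rewrite mulr_ge0 ?ler0n.
have H := computable_first_filtered (fun i : 'I_n => (i, j)) pointing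
  (pred1 (size (positions k))) (enum_uniq 'I_n) nu0 (divr_gt0 nu0 mu0) W0 h_comp.
apply: computable_le H => x; rewrite size_enum_ord; set c := (count _ _)%:R.
have n_nu : n%:R / nu%:R <= nu%:R :> R by rewrite ler_pdivrMr // -natrM ler_nat.
have -> : nu%:R / (mu k)%:R * (3 * (mu k)%:R) = 3 * nu%:R :> R.
  by field; rewrite gt_eqF.
have mu2 : (mu k)%:R ^+ 2 <= 2 ^+ k :> R by rewrite -!natrX ler_nat mu_sqr_le.
have : 3 * (mu k)%:R / (nu%:R / (mu k)%:R) * c <= 3 * 2 ^+ k / nu%:R * c.
  rewrite ler_wpM2r ?ler0n //.
  have -> : 3 * (mu k)%:R / (nu%:R / (mu k)%:R) = 3 * (mu k)%:R ^+ 2 / nu%:R :> R.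
    by field; rewrite !gt_eqF.
  by rewrite ler_wpM2r ?invr_ge0 ?ler0n // ler_wpM2l.
by lra.
Qed.

End Search.

Section Descent.
Local Open Scope ring_scope.
Variables (R : rcfType) (n m K : nat) (sample : {ffun 'I_(2 ^ K) -> 'I_n}).
Local Notation X := {ffun cell n m -> Sigma n m}.
Local Notation comp g w := (computable (fun x : X => x : cell n m -> Sigma n m) g w).
Local Notation hit := (hit sample).
Local Notation clear := (clear sample).
Local Notation next_row := (next_row sample).

Definition zeros (x : X) (j : 'I_m) := #|[set i | ~~ Defs.sval (x (i, j))]|.

Lemma count_pointing (x : X) j :
  (count (fun i : 'I_n => pointing (x (i, j))) (enum 'I_n) <= zeros x j)%N.
Proof.
rewrite -size_filter /zeros cardE; apply: uniq_leq_size.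
  by rewrite filter_uniq ?enum_uniq.
by move=> i; rewrite mem_filter !mem_enum !inE => /andP[/andP[]].
Qed.

(** Raises the level at which the current column is clear from [k] to [k.+1]; [None] records a
    failed search. *)
Definition step k (o : option 'I_m) (x : X) : option 'I_m :=
  if o is Some j then
    if clear k.+1 j x then Some j
    else if onth (enum 'I_n) (next_row k.+1 j x) is Some i
         then bpoint (x (i, j)) else None
  else None.

(** Testing the column, searching a row, reading its pointer; the factor 2 pays for erasing all but
    the new column. *)
Definition step_cost (nu k : nat) (o : option 'I_m) (x : X) : R :=
  if o is Some j then
    2 * (3 * (mu k.+1)%:R +
         (5 * nu%:R + 3 * 2 ^+ k.+1 / nu%:R * (zeros x j)%:R) + 1)
  else 0.

Lemma computable_step nu k o : (k < K)%N -> (0 < nu)%N -> (n <= nu ^ 2)%N ->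
  comp (step k o) (step_cost nu k o).
Proof.
move=> lt_kK nu_gt0 n_le; case: o => [j|]; last exact: (computable_const R _ None).
have H1 := computable_hit R sample j lt_kK.
have H2 := computable_next_row R sample j lt_kK nu_gt0 n_le.
pose h2 v x := if v == size (positions K k.+1) then 0%N else next_row k.+1 j x.
have C2 v : comp (h2 v) (fun x => 5 * nu%:R + 3 * 2 ^+ k.+1 / nu%:R * (zeros x j)%:R : R).
  have H2' : comp (next_row k.+1 j)
      (fun x => 5 * nu%:R + 3 * 2 ^+ k.+1 / nu%:R * (zeros x j)%:R : R).
    apply: computable_le H2 => x; rewrite lerD2l ler_wpM2l ?ler_nat ?count_pointing //.
    by rewrite divr_ge0 ?mulr_ge0 ?exprn_ge0 ?ler0n.
  rewrite /h2; case: (_ == _) => //; apply: computable_le (computable_const R _ _) => x.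
  by rewrite addr_ge0 ?mulr_ge0 ?invr_ge0 ?exprn_ge0 ?ler0n.
pose h3 (v : nat * nat) (x : X) :=
  if v.1 == size (positions K k.+1) then None
  else if onth (enum 'I_n) v.2 is Some i then Some (x (i, j)) else None.
have C3 v : comp (h3 v) (fun=> 1 : R).
  have C0 : comp (fun=> None : option (Sigma n m)) (fun=> 1 : R).
    by apply: computable_le (computable_const R _ _) => x; rewrite ler01.
  rewrite /h3; case: (_ == _) => //; case: (onth _ _) => // i.
  by apply: computable_eq (computable_query R _ (i, j)) => x y.
pose p (v : nat * nat * option (Sigma n m)) : option 'I_m :=
  if v.1.1 == size (positions K k.+1) then Some j else obind (@bpoint n m) v.2.
have C := computable_comp p (computable_pair (computable_pair H1 C2) C3).
apply: computable_eq (C) => x y; congr (_ == _); rewrite /p /h3 /h2 /step /clear /=.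
  by case: (_ == _) => //=; case: (onth _ _).
by case: (_ == _) => //=; case: (onth _ _).
Qed.

Definition visited (j0 : 'I_m) k x := history (Some j0) step k x.
Definition current (j0 : 'I_m) k x := head (Some j0) (visited j0 k x).

End Descent.

(** * Exact verification of a candidate column *)

Section Verify.
Local Open Scope ring_scope.
Variables (R : rcfType) (n m : nat).
Local Notation X := {ffun cell n m -> Sigma n m}.
Local Notation comp g w := (computable (fun x : X => x : cell n m -> Sigma n m) g w).

Definition leaf_ok (b j : 'I_m) (o : option (cell n m * Sigma n m)) :=
  if o is Some (l, a) then [&& l.2 == j, ~~ Defs.sval a & bpoint a == Some b] else false.

Definition first_zero (b : 'I_m) (x : X) :=
  find (fun i : 'I_n => ~~ Defs.sval (x (i, b))) (enum 'I_n).

Definition first_special (b : 'I_m) (x : X) :=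
  find (fun i : 'I_n => x (i, b) != trivial_sym n m) (enum 'I_n).

Definition other_special (b : 'I_m) (k : nat) (x : X) :=
  find (fun i : 'I_n => (val i != k) && (x (i, b) != trivial_sym n m)) (enum 'I_n).

Definition first_bad_leaf (b : 'I_m) (k : nat) (x : X) :=
  if onth (enum 'I_n) k is Some i then
    find (fun j : 'I_m => (j != b) &&
      ~~ leaf_ok b j (replay (tree_path m j) (i, b) (trace x (tree_path m j) (i, b))))
      (enum 'I_m)
  else 0%N.

(** A search result equal to [n] or [m] means that nothing was found. If there is no special cell,
    [first_bad_leaf] takes the default [0], and [verified] rejects because [k] is not below [n]. *)
Definition verify (b : 'I_m) (x : X) : nat * (nat * (nat * nat)) :=
  let k := first_special b x in
  (first_zero b x, (k, (other_special b k x, first_bad_leaf b k x))).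

Definition verified (v : nat * (nat * (nat * nat))) :=
  [&& v.1 == n, (v.2.1 < n)%N, v.2.2.1 == n & v.2.2.2 == m].

Lemma size_tree_path j : (size (tree_path m j) <= (trunc_log 2 m).+1)%N.
Proof.
rewrite /tree_path /bits; case: ifP => _; rewrite ?size_rcons size_map size_iota //.
Qed.

(** Three row searches cost [2 * nu] each. A leaf test reads at most [trunc_log 2 m + 2] cells, and
    the search over columns multiplies this by [2 * mu]. *)
Lemma computable_verify (nu mu : nat) b :
  (0 < nu)%N -> (n <= nu ^ 2)%N -> (0 < mu)%N -> (m <= mu ^ 2)%N ->
  comp (verify b) (fun=> 6 * nu%:R + 2 * mu%:R * (trunc_log 2 m).+2%:R : R).
Proof.
move=> nu_gt0 n_le mu_gt0 m_le.
have nu0 : 0 < nu%:R :> R by rewrite ltr0n.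
have mu0 : 0 < mu%:R :> R by rewrite ltr0n.
have n_nu : n%:R / nu%:R <= nu%:R :> R by rewrite ler_pdivrMr // -natrM ler_nat.
have m_mu : m%:R / mu%:R <= mu%:R :> R by rewrite ler_pdivrMr // -natrM ler_nat.
have row (g : 'I_n -> Sigma n m -> bool) :
    comp (fun x => find (fun i => g i (x (i, b))) (enum 'I_n)) (fun=> 2 * nu%:R : R).
  have H := computable_first g (enum_uniq 'I_n) nu0 ler01
    (fun i => computable_query R (fun x : X => x : cell n m -> Sigma n m) (i, b)).
  by apply: computable_le H => x; rewrite size_enum_ord; lra.
have leaf k : comp (first_bad_leaf b k) (fun=> 2 * mu%:R * (trunc_log 2 m).+2%:R : R).
  rewrite /first_bad_leaf; case: (onth _ _) => [i|]; last first.
    by apply: computable_le (computable_const R _ _) => x; rewrite !mulr_ge0 ?ler0n.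
  have T (j : 'I_m) : comp (fun x => trace x (tree_path m j) (i, b))
      (fun=> (trunc_log 2 m).+2%:R : R).
    by apply: computable_le (computable_trace R _ _) => x; rewrite ler_nat ltnS size_tree_path.
  have H := computable_first (fun j tr => (j != b) &&
      ~~ leaf_ok b j (replay (tree_path m j) (i, b) tr))
    (enum_uniq 'I_m) mu0 (ler0n R _) T.
  apply: computable_le H => x; rewrite size_enum_ord.
  rewrite [X in _ + X](_ : _ = m%:R / mu%:R * (trunc_log 2 m).+2%:R); last by field; rewrite gt_eqF.
  by rewrite -mulrDl ler_wpM2r ?ler0n //; lra.
have C34 k := computable_pair (row (fun i a => (val i != k) && (a != trivial_sym n m)))
  (fun _ => leaf k).
have C := computable_pair (row (fun i a => ~~ Defs.sval a)) (fun _ =>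
  computable_pair (row (fun i a => a != trivial_sym n m)) C34).
by apply: computable_le C => x; lra.
Qed.

End Verify.

Lemma find_enum (T : finType) (P : pred T) :
  (find P (enum T) == #|T|) = [forall t, ~~ P t].
Proof.
rewrite cardE; apply/eqP/forallP => [find_eq t|noP].
  have := has_find P (enum T); rewrite find_eq ltnn => /hasPn; apply.
  by rewrite mem_enum.
by apply: hasNfind; apply/hasPn => t _; exact: noP.
Qed.

Lemma onth_find_enum (T : finType) (P : pred T) :
  if onth (enum T) (find P (enum T)) is Some t then P t else ~~ [exists t, P t].
Proof.
case def_t: (onth _ _) => [t|].
  have ltP : find P (enum T) < size (enum T) by rewrite -onthTE def_t.
  rewrite -has_find in ltP; have := nth_find t ltP.
  by rewrite (@onth_nth _ t t _ _ def_t).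
have : size (enum T) <= find P (enum T) by rewrite -onthNE def_t.
rewrite leqNgt -has_find; apply: contra => /existsP[t Pt].
by apply/hasP; exists t; rewrite ?mem_enum.
Qed.

(** * Correctness of the verification and of the descent *)

Section Correctness.
Variables (n m : nat).
Local Notation X := {ffun cell n m -> Sigma n m}.

Definition special (x : X) (b : 'I_m) (a : cell n m) :=
  [&& a.2 == b, x a != trivial_sym n m,
      [forall a' : cell n m, ((a'.2 == b) && (a' != a)) ==> (x a' == trivial_sym n m)] &
      [forall j : 'I_m, (j != b) ==>
         match follow x (tree_path m j) a with
         | Some l => [&& l.2 == j, ~~ Defs.sval (x l) & bpoint (x l) == Some b]
         | None => false
         end]].

Definition accepting (x : X) (b : 'I_m) :=
  marked_col x b && [exists a, special x b a].

Lemma accepting_leaf x b j : accepting x b -> j != b ->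
  exists i, ~~ Defs.sval (x (i, j)) /\ bpoint (x (i, j)) = Some b.
Proof.
case/andP=> _ /existsP[a /and4P[_ _ _ /forallP/(_ j)/implyP leaf]] /leaf.
case: (follow _ _ _) => // -[i j'] /= /and3P[/eqP -> l0 /eqP lb].
by exists i.
Qed.

(** Every column other than [b] contains the zero at its leaf, so no second column is marked. *)
Lemma f_nmE x : f_nm x = [exists b, accepting x b].
Proof.
apply/existsP/existsP => -[b].
  by case/and3P=> mark _ spec; exists b; rewrite /accepting mark.
move=> acc; exists b; have /andP[-> ->] := acc; rewrite andbT.
apply/forallP => b'; apply/implyP => /forallP mark'; apply/eqP.
apply: contraTeq isT => neq_b.
by have [i [/negP[]]] := accepting_leaf acc neq_b; apply: mark'.
Qed.

Lemma leaf_okE (x : X) (b j : 'I_m) a :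
  leaf_ok b j (replay (tree_path m j) a (trace x (tree_path m j) a)) =
  match follow x (tree_path m j) a with
  | Some l => [&& l.2 == j, ~~ Defs.sval (x l) & bpoint (x l) == Some b]
  | None => false
  end.
Proof. by rewrite replay_trace; case: (follow _ _ _). Qed.

Lemma verifiedE x b : verified n m (verify b x) = accepting x b.
Proof.
rewrite /verified /verify /= /accepting /marked_col; congr (_ && _).
  rewrite /first_zero -[X in _ == X](card_ord n) find_enum.
  by apply: eq_forallb => i; rewrite negbK.
have := onth_find_enum (fun i : 'I_n => x (i, b) != trivial_sym n m).
rewrite /first_bad_leaf -/(first_special b x).
case def_i: (onth _ _) => [i|] => [xi|no_i]; last first.
  rewrite (_ : (first_special b x < n) = false) /=.
    apply/esym/existsP => -[[i b'] /and4P[/= /eqP -> xi _ _]].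
    by case/existsP: no_i; exists i.
  apply/negbTE; rewrite -leqNgt leq_eqVlt -[n in n == _](card_ord n) eq_sym find_enum.
  by rewrite -negb_exists no_i.
have k_lt : first_special b x < n.
  by rewrite -[n in _ < n](size_enum_ord n) -onthTE def_i.
have k_i : val i = first_special b x.
  by rewrite -[i in LHS](@onth_nth _ i i _ _ def_i) /= nth_enum_ord.
rewrite k_lt /= -k_i.
rewrite /other_special -[X in _ == X](card_ord n) -[X in _ && (_ == X)](card_ord m) !find_enum.
apply/andP/existsP => [[/forallP other /forallP leaf]|[[i' b']]].
  exists (i, b); apply/and4P; split=> //.
    apply/forallP => -[i' b'] /=; apply/implyP => /andP[/eqP -> neq_i].
    have := other i'; rewrite negb_and !negbK => /orP[/eqP/val_inj eq_i|//].
    by rewrite eq_i eqxx in neq_i.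
  apply/forallP => j; apply/implyP => neq_j.
  by have := leaf j; rewrite neq_j negbK leaf_okE.
case/and4P=> /= /eqP -> xi' /forallP other /forallP leaf.
have eq_i : i' = i.
  apply/eqP; apply: contraTT xi => neq_i; rewrite negbK.
  have /implyP := other (i, b); apply; rewrite /= eqxx /=.
  by apply: contraNneq neq_i => -[->].
split; apply/forallP.
  move=> i2; rewrite negb_and !negbK; case: eqP => //= neq_i.
  have /implyP := other (i2, b); apply; rewrite /= eqxx eq_i /=.
  by apply/eqP => -[eq_i2]; rewrite eq_i2 in neq_i.
move=> j; rewrite negb_and !negbK; have := leaf j.
by rewrite leaf_okE eq_i; case: (j == b).
Qed.

End Correctness.

Section DescentCorrectness.
Variables (n m K : nat) (sample : {ffun 'I_(2 ^ K) -> 'I_n}) (j0 : 'I_m).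
Local Notation X := {ffun cell n m -> Sigma n m}.

Lemma currentS k (x : X) :
  current sample j0 k.+1 x = step sample k (current sample j0 k x) x.
Proof. by []. Qed.

Lemma clear_marked k (x : X) b : marked_col x b -> clear sample k b x.
Proof. by move/forallP=> mark; rewrite clearP; apply/allP => t _; apply: mark. Qed.

Lemma current_clear k (x : X) j : current sample j0 k x = Some j -> clear sample k j x.
Proof.
elim: k j => [|k IH] j.
  rewrite clearP /positions => _; apply/allP => t.
  by rewrite mem_filter expn0 subnn ltn0.
rewrite currentS /step; case: (current _ _ _ _) (IH) => [j'|//] _.
case: ifP => [cl [<-] //|_].
have := onth_find_enum (fun i : 'I_n => let a := x (i, j') in
    pointing a && ((if bpoint a is Some b then hit sample k.+1 b x else 0)
      == size (positions K k.+1))).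
rewrite -/(next_row sample k.+1 j' x); case: (onth _ _) => [i|//] /=.
by case/andP=> _; case: (bpoint _) => // b eq_hit [<-].
Qed.

(** A marked column is clear at every level. A column that is not clear thus differs from [b] and
    contains a zero pointing to [b], so the search succeeds. *)
Lemma current_accepting k (x : X) b : accepting x b ->
  exists j, current sample j0 k x = Some j.
Proof.
move=> acc; elim: k => [|k [j cur_j]]; first by exists j0.
rewrite currentS cur_j /step; case: (boolP (clear _ _ _ _)) => [_|nclear]; first by exists j.
have neq_j : j != b.
  by apply: contraNneq nclear => ->; apply: clear_marked; case/andP: acc.
have [i [l0 lb]] := accepting_leaf acc neq_j.
have := onth_find_enum (fun i : 'I_n => let a := x (i, j) in
    pointing a && ((if bpoint a is Some b then hit sample k.+1 b x else 0)
      == size (positions K k.+1))).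
rewrite -/(next_row sample k.+1 j x); case: (onth _ _) => [i'|/existsP[]] /=.
  by case/andP=> /andP[_]; case: (bpoint _) => // b' _ _; exists b'.
exists i; rewrite /pointing l0 lb /=; apply: clear_marked.
by case/andP: acc.
Qed.

(** The sample is representative: for all columns and levels at once, surviving [2 ^ k - 1] sampled
    rows certifies few zeros. *)
Definition good_sample (L : nat) (x : X) :=
  [forall j : 'I_m, forall k : 'I_K.+1,
    clear sample k j x ==> (zeros x j * (2 ^ k - 1) < n * L)].

(** Since [n * L <= 2 ^ K - 1], a column clear at level [K] has no zero at all, whereas every column
    other than the accepting one has a zero. *)
Lemma descent_correct L (x : X) : n * L < 2 ^ K -> good_sample L x ->
  (if current sample j0 K x is Some b then accepting x b else false) = f_nm x.
Proof.
move=> nL good; rewrite f_nmE; apply/idP/existsP.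
  by case: (current _ _ _ _) => // b acc; exists b.
move=> [b acc]; have [j cur_j] := current_accepting K acc.
rewrite cur_j; have cl := current_clear cur_j.
suff -> : j = b by [].
apply/eqP; apply: contraTT cl => neq_j; apply/negP => cl.
have [i [l0 _]] := accepting_leaf acc neq_j.
have /forallP/(_ j)/forallP/(_ ord_max)/implyP/(_ cl) /= := good.
have : 0 < zeros x j by apply/card_gt0P; exists i; rewrite inE.
move: (zeros x j) (2 ^ K) nL => z q; nia.
Qed.

End DescentCorrectness.

(** * Counting the bad samples *)

Lemma pow_add_le a k : a ^ k * (a + k) <= a * a.+1 ^ k.
Proof.
elim: k => [|k IH]; first by rewrite !expn0 mul1n muln1 addn0.
rewrite !expnS; set u := a ^ k in IH *; set v := a.+1 ^ k in IH *; nia.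
Qed.

(** Bernoulli's inequality: [(1 + 1/a)^n >= 1 + n/a >= 2]. *)
Lemma pow_double_le a n : 0 < n -> a <= n -> 2 * a ^ n <= a.+1 ^ n.
Proof.
move=> n_gt0; case: a => [|a] a_le; first by rewrite exp0n ?muln0.
have := pow_add_le a.+1 n; set u := a.+1 ^ n; set v := a.+2 ^ n => h.
rewrite -(leq_pmul2l (ltn0Sn a)); apply: leq_trans h.
by rewrite mulnCA [u * _]mulnC mulnA leq_mul2r; apply/orP; right; lia.
Qed.

(** [(1 - z/n)^n <= 2^(-z)]: each unit removed from the base at least halves the power. *)
Lemma pow_sub_le n z : 0 < n -> z <= n -> (n - z) ^ n * 2 ^ z <= n ^ n.
Proof.
move=> n_gt0; elim: z => [|z IH] z_le; first by rewrite subn0 expn0 muln1.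
apply: leq_trans (IH (ltnW z_le)); rewrite expnS mulnA leq_mul2r; apply/orP; right.
by rewrite mulnC -[n - z](subnSK z_le) pow_double_le // leq_subr.
Qed.

(** Bounds by [2^(-L)] the probability [(1 - z/n)^s] that [s] uniform rows miss all [z] zeros, by
    comparing [n]-th powers. *)
Lemma pow_miss_le n z s L : 0 < n -> z <= n -> n * L <= z * s ->
  (n - z) ^ s * 2 ^ L <= n ^ s.
Proof.
move=> n_gt0 z_le zs; rewrite -(leq_exp2r _ _ n_gt0) expnMn -!expnM.
apply: (@leq_trans ((n - z) ^ (s * n) * 2 ^ (z * s))).
  by rewrite leq_mul2l leq_exp2l // [L * n]mulnC zs orbT.
case: (posnP s) => [->|s_gt0]; first by rewrite muln0 mul0n !expn0.
by rewrite [s * n]mulnC !expnM -expnMn leq_exp2r // pow_sub_le.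
Qed.

Section Sampling.
Variables (n m K L : nat) (x : {ffun cell n m -> Sigma n m}).
Hypothesis n_gt0 : 0 < n.

(** The samples in question form a product set: the first [2 ^ k - 1] entries avoid the zeros, the
    others are free. *)
Lemma card_clear (j : 'I_m) k : k <= K ->
  #|[set s : {ffun 'I_(2 ^ K) -> 'I_n} | clear s k j x]| * n ^ (2 ^ k - 1) =
  (n - zeros x j) ^ (2 ^ k - 1) * #|{: {ffun 'I_(2 ^ K) -> 'I_n}}|.
Proof.
move=> le_kK; pose F (t : 'I_(2 ^ K)) : pred 'I_n :=
  if t < 2 ^ k - 1 then [pred i | Defs.sval (x (i, j))] else predT.
have -> : #|[set s : {ffun 'I_(2 ^ K) -> 'I_n} | clear s k j x]| = #|finfun.family F|.
  apply: eq_card => s; rewrite inE clearP; apply/allP/familyP => [all_s t|fam t].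
    rewrite /F; case: ifP => // lt_t; apply: all_s.
    by rewrite mem_filter lt_t mem_enum.
  by rewrite mem_filter => /andP[lt_t _]; have := fam t; rewrite /F lt_t.
pose P : pred 'I_(2 ^ K) := fun t => t < 2 ^ k - 1.
have card_P : #|P| = 2 ^ k - 1.
  rewrite -(size_positions le_kK) cardE; apply/perm_size/uniq_perm.
  - exact: enum_uniq.
  - exact: positions_uniq.
  - by move=> t; rewrite mem_enum mem_filter mem_enum andbT.
have card_F t : #|F t| = if P t then n - zeros x j else n.
  rewrite /F /P; case: ifP => _; last by rewrite cardT size_enum_ord.
  have -> : n - zeros x j = #|~: [set i | ~~ Defs.sval (x (i, j))]|.
    by rewrite [RHS]cardsCs setCK card_ord.
  by apply: eq_card => i; rewrite !inE negbK.
have prodE : \prod_t #|F t| = (n - zeros x j) ^ (2 ^ k - 1) * n ^ #|predC P|.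
  rewrite (bigID P) /= -card_P -!prod_nat_const.
  congr (_ * _); apply: eq_bigr => t; first by rewrite card_F => ->.
  by rewrite card_F => /negbTE ->.
rewrite card_family card_ffun !card_ord foldrE big_map big_enum /= prodE.
by rewrite -mulnA -expnD addnC -card_P cardC card_ord.
Qed.

(** Union bound over the pairs of a column and a level: a column with too many zeros is clear with
    probability at most [2^(-L)]. *)
Lemma card_bad_sample :
  #|[pred s : {ffun 'I_(2 ^ K) -> 'I_n} | ~~ good_sample s L x]| * 2 ^ L <=
  m * K.+1 * #|{: {ffun 'I_(2 ^ K) -> 'I_n}}|.
Proof.
pose B (jk : 'I_m * 'I_K.+1) := if n * L <= zeros x jk.1 * (2 ^ jk.2 - 1)
  then [set s : {ffun 'I_(2 ^ K) -> 'I_n} | clear s jk.2 jk.1 x] else set0.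
have B_le jk : #|B jk| * 2 ^ L <= #|{: {ffun 'I_(2 ^ K) -> 'I_n}}|.
  rewrite /B; case: ifP => [zs|_]; last by rewrite cards0 mul0n.
  have le_z : zeros x jk.1 <= n by rewrite -[n in _ <= n]card_ord max_card.
  have k_le : jk.2 <= K by rewrite -ltnS.
  have := pow_miss_le n_gt0 le_z zs; have := card_clear jk.1 k_le.
  have : 0 < n ^ (2 ^ jk.2 - 1) by rewrite expn_gt0 n_gt0.
  set a := #|_|; set b := n ^ _; set c := _ ^ (2 ^ jk.2 - 1); set d := #|_|.
  move=> b_gt0 eq_ab le_cb; rewrite -(leq_pmul2l b_gt0).
  by rewrite mulnA [b * a]mulnC eq_ab mulnAC leq_mul2r le_cb orbT.
have bad_B : [pred s | ~~ good_sample s L x] \subset \bigcup_jk B jk.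
  apply/subsetP => s; rewrite inE => /forallPn[j /forallPn[k]].
  rewrite negb_imply -leqNgt => /andP[cl zs]; apply/bigcupP; exists (j, k) => //.
  by rewrite /B zs inE.
apply: leq_trans (leq_mul (subset_leq_card bad_B) (leqnn _)) _.
apply: (@leq_trans ((\sum_jk #|B jk|) * 2 ^ L)).
  rewrite leq_mul2r; apply/orP; right.
  elim/big_rec2: _ => [|jk U a _ le_U]; first by rewrite cards0.
  by apply: leq_trans (leq_card_setU _ _) _; rewrite leq_add2l.
rewrite big_distrl /=.
apply: (@leq_trans (\sum_(jk : 'I_m * 'I_K.+1) #|{: {ffun 'I_(2 ^ K) -> 'I_n}}|)).
  by apply: leq_sum => jk _; exact: B_le.
by rewrite sum_nat_const card_prod !card_ord.
Qed.

End Sampling.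

(** * Choice of parameters and total cost *)

Section QueryBound.
Variables (n m : nat).
Hypotheses (n_gt0 : 0 < n) (m_gt0 : 0 < m).
Local Notation X := {ffun cell n m -> Sigma n m}.

(** Dominates the depth, and also the exponent [7 + (t + 1) + (t + 3)] of the union bound, where
    [t = trunc_log 2 (n + m)]. *)
Definition log_scale := 2 * trunc_log 2 (n + m) + 12.
Definition depth := (trunc_log 2 (n * log_scale)).+1.
Definition root_bound k := (Nat.sqrt k).+1.
Definition cost_bound := 60 * log_scale ^ 2 * (root_bound n + root_bound m).

Local Notation L := log_scale.
Local Notation K := depth.
Local Notation nu := (root_bound n).
Local Notation mu' := (root_bound m).

Lemma le_root_bound k : k <= root_bound k ^ 2.
Proof. by have [_ h] := Nat.sqrt_spec k (Nat.le_0_l k); rewrite /root_bound; lia. Qed.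

Lemma log_scale_gt0 : 0 < L.
Proof. by rewrite /log_scale addnS. Qed.

Lemma lt_depth : n * L < 2 ^ K.
Proof. by rewrite trunc_log_ltn. Qed.

Lemma depth_le : 2 ^ K <= 2 * (n * L).
Proof. by rewrite expnS leq_mul2l trunc_logP // muln_gt0 n_gt0 log_scale_gt0. Qed.

Lemma linear_le_exp t : t.+1 <= 2 ^ t.
Proof. exact: ltn_expl. Qed.

Lemma depth_le_log : K <= 2 * trunc_log 2 (n + m) + 5.
Proof.
set t := trunc_log 2 (n + m).
have nm_lt : n + m < 2 ^ t.+1 by exact: trunc_log_ltn.
have L_le : L <= 2 ^ (t + 4).
  by rewrite expnD /log_scale -/t; have := linear_le_exp t; lia.
rewrite /depth -addn1 -(addn1 4) [X in _ <= X]addnA leq_add2r.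
rewrite -ltnS -(ltn_exp2l _ _ (ltnSn 1)).
apply: leq_ltn_trans (trunc_logP _ _) _ => //; first by rewrite muln_gt0 n_gt0 log_scale_gt0.
apply: (@leq_ltn_trans (n * 2 ^ (t + 4))); first by rewrite leq_mul2l L_le orbT.
rewrite (_ : (2 * t + 4).+1 = t.+1 + (t + 4)); last by lia.
rewrite [X in _ < X]expnD ltn_pmul2r ?expn_gt0 //.
by apply: leq_ltn_trans nm_lt; rewrite leq_addr.
Qed.

Lemma union_bound : 100 * (m * K.+1) <= 2 ^ L.
Proof.
have := depth_le_log; rewrite /log_scale; set t := trunc_log 2 (n + m) => K_le.
have nm_lt : n + m < 2 ^ t.+1 by exact: trunc_log_ltn.
have K_le' : K.+1 <= 2 ^ (t + 3).
  by rewrite expnD; have := linear_le_exp t; lia.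
have m_le : m <= 2 ^ t.+1 by apply: leq_trans (ltnW nm_lt); rewrite leq_addl.
apply: (@leq_trans (2 ^ 7 * (2 ^ t.+1 * 2 ^ (t + 3)))).
  by rewrite leq_mul // leq_mul.
by rewrite -!expnD leq_exp2l //; lia.
Qed.

Local Open Scope ring_scope.

Lemma step_cost_le (F : rcfType) (sample : {ffun 'I_(2 ^ K) -> 'I_n}) (j0 : 'I_m) k (x : X) :
  (k < K)%N -> good_sample sample L x ->
  step_cost F nu k (current sample j0 k x) x <= 48 * L%:R * nu%:R.
Proof.
move=> lt_kK good; have nu0 : 0 < nu%:R :> F by rewrite ltr0n.
have nu1 : 1 <= nu%:R :> F by rewrite ler1n.
have L1 : 1 <= L%:R :> F by rewrite ler1n log_scale_gt0.
have Lnu : nu%:R <= L%:R * nu%:R :> F by rewrite ler_peMl // ltW.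
case cur_j: (current _ _ _ _) => [j|] /=; last by rewrite !mulr_ge0 ?ler0n.
have cl := current_clear cur_j.
have /forallP/(_ j)/forallP/(_ (Ordinal (ltnW lt_kK : (k < K.+1)%N)))/implyP/(_ cl) /= z_lt := good.
have z_le : (zeros x j <= n)%N by rewrite -[leqRHS]card_ord max_card.
(* Adding [zeros x j <= n] replaces [2 ^ k - 1] by [2 ^ k]. *)
have zk_le : (zeros x j * 2 ^ k <= n * L.+1)%N.
  have : (0 < 2 ^ k)%N by rewrite expn_gt0.
  move: (zeros x j) (2 ^ k)%N z_lt z_le => z q; nia.
(* Squared: [2 ^ k.+1 <= 2 ^ K <= 2 * n * L <= (2 * L * nu) ^ 2]. *)
have mu_le : (mu k.+1)%:R <= 2 * (L%:R * nu%:R) :> F.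
  rewrite -!natrM ler_nat -(@leq_exp2r _ _ 2) //.
  apply: leq_trans (mu_sqr_le _) _.
  apply: (@leq_trans (2 ^ K)%N); first by rewrite leq_exp2l.
  apply: leq_trans depth_le _; have := le_root_bound n; have := log_scale_gt0.
  rewrite !expnMn; move: L (nu ^ 2)%N => a b a_gt0 le_nb.
  apply: (@leq_trans (2 * (b * a))%N); first by rewrite leq_mul2l leq_mul2r le_nb orbT.
  have : (b * a <= (a * a) * b)%N by rewrite mulnC leq_mul2r leq_pmulr // orbT.
  by rewrite -(mulnn a); nia.
have z_cost : 3 * 2 ^+ k.+1 / nu%:R * (zeros x j)%:R <= 6 * (L%:R + 1) * nu%:R :> F.
  rewrite mulrAC ler_pdivrMr // -[2]/(2%:R) -natrX -[3]/(3%:R) -[6]/(6%:R) natr1.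
  rewrite -!natrM ler_nat expnS.
  have := le_root_bound n; move: (zeros x j) (2 ^ k)%N zk_le => z q zq.
  move: L nu zq => a b zq nb.
  apply: (@leq_trans (6 * (n * a.+1))%N); first by nia.
  by rewrite -!mulnA leq_mul2l /= mulnC leq_mul2l mulnn nb orbT.
lra.
Qed.

Definition verify_cost (F : rcfType) : F :=
  6 * nu%:R + 2 * mu'%:R * (trunc_log 2 m).+2%:R.

(** At most [L] levels cost [48 * L * nu] each; the verification adds at most
    [6 * nu + 2 * mu' * L]. *)
Lemma total_cost_le (F : rcfType) (sample : {ffun 'I_(2 ^ K) -> 'I_n}) (j0 : 'I_m)
    (x : X) : good_sample sample L x ->
  \sum_(k < K) step_cost F nu k (current sample j0 k x) x + verify_cost F <=
  cost_bound%:R.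
Proof.
move=> good.
have steps : \sum_(k < K) step_cost F nu k (current sample j0 k x) x <=
    48 * L%:R ^+ 2 * nu%:R.
  apply: (@le_trans _ _ (\sum_(k < K) 48 * L%:R * nu%:R)).
    by apply: ler_sum => k _; apply: step_cost_le.
  rewrite sumr_const card_ord -[leLHS]mulr_natr expr2 mulrA [48 * L%:R * nu%:R * _]mulrAC.
  rewrite !ler_wpM2r ?ler0n // ler_wpM2l ?mulr_ge0 ?ler0n // ler_nat.
  by apply: leq_trans depth_le_log _; rewrite /log_scale leq_add2l.
have cv_le : verify_cost F <= 6 * nu%:R + 2 * mu'%:R * L%:R.
  rewrite lerD2l ler_wpM2l ?mulr_ge0 ?ler0n // ler_nat /log_scale.
  have : (trunc_log 2 m <= trunc_log 2 (n + m))%N by rewrite leq_trunc_log ?leq_addl.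
  lia.
have L1 : 1 <= L%:R :> F by rewrite ler1n log_scale_gt0.
have L2 : L%:R <= L%:R ^+ 2 :> F by rewrite expr2 ler_peMl ?ler0n.
have nu_le : nu%:R <= L%:R ^+ 2 * nu%:R :> F.
  by rewrite ler_peMl ?ler0n // (le_trans L1).
have mu_le : mu'%:R * L%:R <= L%:R ^+ 2 * mu'%:R :> F.
  by rewrite mulrC ler_wpM2r ?ler0n.
have nu_ge0 : 0 <= nu%:R :> F by rewrite ler0n.
have mu_ge0 : 0 <= L%:R ^+ 2 * mu'%:R :> F by rewrite mulr_ge0 ?exprn_ge0 ?ler0n.
rewrite /cost_bound natrM natrM natrD natrX.
by apply: le_trans (lerD steps cv_le) _; lra.
Qed.

Lemma query_bound : Q_le (@f_nm n m) (50 * cost_bound).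
Proof.
pose i0 := Ordinal n_gt0; pose j0 := Ordinal m_gt0.
pose S := {ffun 'I_(2 ^ K) -> 'I_n}.
(* After a failed descent a dummy value is returned, and [out] rejects. *)
pose check (v : seq (option 'I_m)) (x : X) :=
  if head (Some j0) v is Some b then verify b x else (0, (0, (0, 0)))%N.
pose h (s : S) x := (visited s j0 K x, check (visited s j0 K x) x).
pose out (s : S) (v : seq (option 'I_m) * (nat * (nat * (nat * nat)))) :=
  if head (Some j0) v.1 is Some _ then verified n m v.2 else false.
apply: (las_vegas_quantum (i0, j0) (trivial_sym n m) [ffun=> i0] (h := h) (out := out)
  (w := fun s x => \sum_(k < K) step_cost _ nu k (current s j0 k x) x + verify_cost _)
  (good := fun x s => good_sample s L x)).
- by rewrite !muln_gt0 ?expn_gt0 log_scale_gt0.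
- move=> s; apply: (computable_pair (g := visited s j0 K) (h := check)
      (w' := fun _ _ => verify_cost _)) => [|v].
    apply: computable_history => k o lt_kK.
    by apply: computable_step; rewrite ?le_root_bound.
  rewrite /check; case: (head _ v) => [b|].
    by apply: computable_verify; rewrite ?le_root_bound.
  apply: computable_le (computable_const _ _ _) => x.
  by rewrite addr_ge0 ?mulr_ge0 ?ler0n.
- move=> x s good; rewrite -(descent_correct j0 lt_depth good) /current /out /h.
  move: (visited s j0 K x) => v /=; rewrite /check.
  by case: (head _ v) => //= b; exact: verifiedE.
- by move=> x s; apply: total_cost_le.
- move=> x; have := card_bad_sample K L x n_gt0.
  have := union_bound; set b := #|_|; set c := #|_| => le_L le_b.
  (* Cancelling [m * K.+1] between the union bound and the count of bad samples leaves at most one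
     bad sample in a hundred. *)
  have mK_gt0 : (0 < m * K.+1)%N by rewrite muln_gt0 m_gt0.
  rewrite -(leq_pmul2l mK_gt0) mulnA [(m * _ * 100)%N]mulnC.
  apply: leq_trans (leq_mul le_L (leqnn b)) _.
  by rewrite mulnC (leq_trans le_b).
Qed.

End QueryBound.

(** * Asymptotics *)

Section Asymptotics.
Local Open Scope R_scope.

Lemma INR_root_bound k : (0 < k)%N -> INR (root_bound k) <= 2 * sqrt (INR k).
Proof.
move=> k_gt0; rewrite /root_bound S_INR.
have k1 : 1 <= INR k by apply: (le_INR 1); apply/ssrnat.leP.
have s1 : 1 <= sqrt (INR k) by rewrite -sqrt_1; apply: sqrt_le_1_alt.
have : INR (Nat.sqrt k) <= sqrt (INR k).
  rewrite -(sqrt_square (INR (Nat.sqrt k))); last exact: pos_INR.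
  apply: sqrt_le_1_alt; rewrite -mult_INR; apply: le_INR.
  by have [] := Nat.sqrt_spec k (Nat.le_0_l k).
by move=> h; Lra.lra.
Qed.

Lemma INR_expn a k : INR (expn a k) = INR a ^ k.
Proof. by elim: k => //= k <-; rewrite expnS mult_INR. Qed.

Lemma INR_log_scale n m : (0 < n)%N -> (0 < m)%N ->
  INR (log_scale n m) <= 12 * (1 + ln (INR (n + m))).
Proof.
move=> n_gt0 m_gt0; rewrite /log_scale plus_INR mult_INR; set t := trunc_log 2 _.
have nm_gt0 : (0 < n + m)%N by rewrite addn_gt0 n_gt0.
have pow_t : INR 2 ^ t <= INR (n + m).
  by rewrite -INR_expn; apply: le_INR; apply/ssrnat.leP; exact: trunc_logP.
have ln_t : INR t * ln 2 <= ln (INR (n + m)).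
  rewrite -ln_pow; last by Lra.lra.
  have pow_gt0 : 0 < INR 2 ^ t by apply: pow_lt; rewrite /=; Lra.lra.
  have [lt_pow|<-] := Rle_lt_or_eq_dec _ _ pow_t; last exact: Rle_refl.
  by apply/Rlt_le/ln_increasing.
(* As [ln 2 > 1/2], the bound on [t * ln 2] gives [2 * t <= 4 * ln (n + m)]. *)
have := ln_lt_2; have := pos_INR t.
have -> : INR 12 = 12 by rewrite /=; Lra.lra.
have -> : INR 2 = 2 by [].
move: ln_t; move: (ln _) (ln 2) (INR t) => a b c; Lra.nra.
Qed.

End Asymptotics.

(* Q(f_{n,m}) = O~(sqrt n + sqrt m): there are constants C > 0 and k such
   that for all positive n, m,
   Q(f_{n,m}) <= C (sqrt n + sqrt m) (1 + ln (n + m))^k. *)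
Theorem theorem5 :
  exists (C : R) (k : nat), (0 < C)%R /\
    forall n m : nat, (0 < n)%N -> (0 < m)%N ->
      exists T : nat,
        Q_le (@f_nm n m) T /\
        (INR T <= C * (sqrt (INR n) + sqrt (INR m)) * (1 + ln (INR (n + m))) ^ k)%R.
Proof.
(* [864000 = 50 * 60 * 12^2 * 2]: queries per unit of cost, [cost_bound], the squared [log_scale],
   and [root_bound]. The exponent 2 is that of [log_scale]. *)
exists 864000%R, 2; split; first by Lra.lra.
move=> n m n_gt0 m_gt0; exists (50 * cost_bound n m).
split; first exact: query_bound.
rewrite /cost_bound 3!mult_INR INR_expn (plus_INR (root_bound n)).
have := INR_root_bound n_gt0; have := INR_root_bound m_gt0.
have := INR_log_scale n_gt0 m_gt0.
have := pos_INR (log_scale n m).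
have := pos_INR (root_bound n); have := pos_INR (root_bound m).
move: (INR (log_scale n m)) (INR (root_bound n)) (INR (root_bound m)).
move: (1 + ln _)%R (sqrt (INR n)) (sqrt (INR m)) => a s t L u v v0 u0 L0 La vt us.
have -> : INR 50 = 50%R by rewrite INR_IZR_INZ.
have -> : INR 60 = 60%R by rewrite INR_IZR_INZ.
have LL : (L ^ 2 <= 144 * a ^ 2)%R by Lra.nra.
have uv : (u + v <= 2 * (s + t))%R by Lra.lra.
have uv0 : (0 <= u + v)%R by Lra.lra.
have L20 : (0 <= L ^ 2)%R by Lra.nra.
apply: (Rle_trans _ (3000 * (L ^ 2 * (u + v)))%R); first by Lra.lra.
apply: (Rle_trans _ (3000 * ((144 * a ^ 2) * (2 * (s + t))))%R); last by Lra.lra.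
apply: Rmult_le_compat_l; first by Lra.lra.
exact: Rmult_le_compat.
Qed.
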